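(* Let $O\subseteq\mathbb R^N$ be an open semialgebraic set and let $F:O\to\mathbb R$ be a continuous semialgebraic function. Then $F$ is lower elementary.
   Context: Semialgebraic means definable without parameters in the ordered field $\mathbb R$. A class of functions $\mathbb N^n\to\mathbb N$ ($n$ varying) is good if it contains all constant functions, projections, the successor function and $x\dot- y=\max\{0,x-y\}$, and is closed under composition and bounded summation $f(\bar x,y)=\sum_{i=0}^y g(\bar x,i)$; the lower elementary functions form the smallest good class. Functions involving $\mathbb Q$ are coded by natural numbers ($z\in\mathbb Z$ by $(\max(z,0),-\min(0,z))$, $r\in\mathbb Q$ by $(z,n)$ with $r=z/n$, $n>0$, $\gcd(z,n)=1$) and are lower elementary if the coded function is componentwise lower elementary. On $\mathbb R^N$ use the maximum norm. For open $O\subseteq\mathbb R^N$ and integer $e\ge1$ let $O_e=\{x\in O:|x|\le e,\ \mathrm{dist}(x,\mathbb R^N\setminus O)\ge1/e\}$. A function $F:O\to\mathbb R$ is lower elementary if there are lower elementary functions $d:\mathbb N\to\mathbb N$ and $f:\mathbb Q^N\times\mathbb N\to\mathbb Q$ such that for all integers $e\ge1$, all $a\in\mathbb Q^N$ and all $x\in O_e$: $|x-a|<1/d(e)$ implies $|F(x)-f(a,e)|<1/e$. *)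

(* Defs.v *)
From HB Require Import structures.
From mathcomp Require Import all_boot all_order all_algebra.
From mathcomp Require Import all_classical all_reals all_analysis.
From mathcomp Require Import ordered_qelim.

Set Implicit Arguments.
Unset Strict Implicit.
Unset Printing Implicit Defensive.

Import Order.TTheory GRing.Theory Num.Theory.
Import numFieldNormedType.Exports.

Local Open Scope classical_set_scope.
Local Open Scope ring_scope.

(* No element of T may occur in the term: only variables, numerals and the
   operations of the language of ordered rings are allowed. *)
Fixpoint parameter_free_term (T : Type) (t : GRing.term T) : bool :=
  match t with
  | GRing.Var _ | GRing.NatConst _ => true
  | GRing.Const _ | GRing.Inv _ => false
  | GRing.Add t1 t2 | GRing.Mul t1 t2 =>
      parameter_free_term t1 && parameter_free_term t2
  | GRing.Opp t1 | GRing.NatMul t1 _ | GRing.Exp t1 _ =>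
      parameter_free_term t1
  end.

Fixpoint parameter_free (T : Type) (phi : ord.formula T) : bool :=
  match phi with
  | ord.Bool _ => true
  | ord.Equal t1 t2 | ord.Lt t1 t2 | ord.Le t1 t2 =>
      parameter_free_term t1 && parameter_free_term t2
  | ord.Unit _ => false
  | ord.And p q | ord.Or p q | ord.Implies p q =>
      parameter_free p && parameter_free q
  | ord.Not p | ord.Exists _ p | ord.Forall _ p => parameter_free p
  end.

(* [ord.holds] reads variables beyond the n coordinates as 0, so they do not
   act as parameters. *)
Definition semialgebraic (R : realType) (n : nat) (A : set 'rV[R]_n) : Prop :=
  exists2 phi : ord.formula R, parameter_free phi &
    A = [set x | ord.holds [seq x 0 i | i <- enum 'I_n] phi].

(* A function on O is represented by a total function of which only the
   values on O matter. *)
Definition graph_on (R : realType) (N : nat) (O : set 'rV[R]_N)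
    (F : 'rV[R]_N -> R) : set 'rV[R]_(N + 1) :=
  [set row_mx x (F x)%:M | x in O].

Definition semialgebraic_fun (R : realType) (N : nat) (O : set 'rV[R]_N)
    (F : 'rV[R]_N -> R) : Prop :=
  semialgebraic (graph_on O F).

Definition function_class := forall n : nat, set (n.-tuple nat -> nat).

Record good (C : function_class) : Prop := Good {
  good_const : forall n c, C n (fun=> c);
  good_proj : forall n (i : 'I_n), C n (fun x => tnth x i);
  good_succ : C 1%N (fun x => (tnth x ord0).+1);
  good_sub : C 2%N (fun x => tnth x ord0 - tnth x ord_max)%N;
  good_comp : forall m n (g : m.-tuple nat -> nat)
    (h : 'I_m -> n.-tuple nat -> nat),
    C m g -> (forall i, C n (h i)) -> C n (fun x => g [tuple h i x | i < m]);
  good_sum : forall n (g f : n.+1.-tuple nat -> nat),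
    C n.+1 g ->
    (forall (x : n.-tuple nat) (y : nat),
      f [tuple of rcons x y] = \sum_(0 <= i < y.+1) g [tuple of rcons x i])%N ->
    C n.+1 f
}.

Definition lower_elementary (n : nat) (f : n.-tuple nat -> nat) : Prop :=
  forall C : function_class, good C -> C n f.

Definition rat_code (r : rat) : 3.-tuple nat :=
  [tuple absz (Num.max (numq r) 0); absz (Num.min 0 (numq r)); absz (denq r)].

Definition input_code (N : nat) (a : 'rV[rat]_N) (e : nat) :
    (N * 3).+1.-tuple nat :=
  [tuple of rcons
    (allpairs (fun i => tnth (rat_code (a 0 i))) (ord_tuple N) (ord_tuple 3))
    e].

(* The coded function is only determined on codes of rationals; its components
   have to be lower elementary functions restricted to the set of codes. *)
Definition lower_elementary_rat (N : nat) (f : 'rV[rat]_N -> nat -> rat)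
    : Prop :=
  forall j : 'I_3, exists2 g : (N * 3).+1.-tuple nat -> nat,
    lower_elementary g &
    forall a e, tnth (rat_code (f a e)) j = g (input_code a e).

(* The norm on row vectors is the maximum norm; the distance to the empty set
   is +oo. *)
Definition dist (R : realType) (N : nat) (x : 'rV[R]_N) (A : set 'rV[R]_N)
    : \bar R :=
  ereal_inf [set (`|x - y|)%:E | y in A].

Definition core (R : realType) (N : nat) (O : set 'rV[R]_N) (e : nat)
    : set 'rV[R]_N :=
  [set x | [/\ O x, `|x| <= e%:R & ((e%:R^-1)%:E <= dist x (~` O))%E]].

(* Since x / 0 = 0, the positivity of d e has to be required explicitly. *)
Definition lower_elementary_real (R : realType) (N : nat) (O : set 'rV[R]_N)
    (F : 'rV[R]_N -> R) : Prop :=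
  exists (d : nat -> nat) (f : 'rV[rat]_N -> nat -> rat),
    [/\ lower_elementary (fun x : 1.-tuple nat => d (tnth x ord0)),
        lower_elementary_rat f,
        forall e, (1 <= e)%N -> (0 < d e)%N &
        forall (e : nat) (a : 'rV[rat]_N) (x : 'rV[R]_N),
          (1 <= e)%N -> core O e x ->
          `|x - map_mx ratr a| < (d e)%:R^-1 ->
          `|F x - ratr (f a e)| < e%:R^-1].

(* Main.v *)
Require Import Defs.
From mathcomp Require Import all_boot all_order all_algebra.
From mathcomp Require Import all_classical all_reals all_analysis.
From mathcomp Require Import ordered_qelim polyrcf lra ring zify.
From mathcomp Require qe_rcf_th qe_rcf.

Set Implicit Arguments.
Unset Strict Implicit.
Unset Printing Implicit Defensive.

Import Order.TTheory GRing.Theory Num.Theory.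
Import numFieldNormedType.Exports.

Local Open Scope classical_set_scope.
Local Open Scope ring_scope.

(** Quantifier elimination over the reals introduces only rational constants, so
    a parameter-free definable relation is decided, at rational points, by signs
    of rational polynomials, hence by lower elementary functions.

    Let M be the set of pairs (E, d) such that d is a modulus of continuity of F
    for the precision 1/(2E) on the E-core of O and |F| <= 1/d there.  It is
    definable, so it is described by finitely many bivariate polynomials, each of
    which has constant sign on a cusp {E >= C, 0 < d <= E^-k}: the lowest power of
    d dominates.  Hence M contains such a cusp or is disjoint from it, and
    compactness of the cores excludes the latter.  So d(e) = (e + c)^k works.

    Finally F(a) is computed by counting the j <= 2Bn with -B + j/n <= F(a), where
    |F(a)| <= B.  If m is this count, the value returned is m/n - B + 1/n^2 rather
    than m/n - B: its reduced form has the explicit numerator (m - Bn)n + 1 and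
    denominator n^2. *)

(** * Rational constants in quantifier elimination *)

Section RationalQE.

Variable R : rcfType.

(** Quantifier elimination does not preserve [parameter_free], because it inserts constants such as
    [-1] and [1/2]. Rationality of all constants is the invariant that survives. *)
Definition rational_number (c : R) : bool := `[< exists q : rat, c = ratr q >].

Fixpoint rational_term (t : GRing.term R) : bool :=
  match t with
  | GRing.Var _ | GRing.NatConst _ => true
  | GRing.Const c => rational_number c
  | GRing.Inv _ => false
  | GRing.Add t1 t2 | GRing.Mul t1 t2 => rational_term t1 && rational_term t2
  | GRing.Opp t1 | GRing.NatMul t1 _ | GRing.Exp t1 _ => rational_term t1
  end.

Fixpoint rational_formula (f : ord.formula R) : bool :=
  match f with
  | ord.Bool _ => true
  | ord.Equal t1 t2 | ord.Lt t1 t2 | ord.Le t1 t2 =>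
      rational_term t1 && rational_term t2
  | ord.Unit _ => false
  | ord.And p q | ord.Or p q | ord.Implies p q =>
      rational_formula p && rational_formula q
  | ord.Not p | ord.Exists _ p | ord.Forall _ p => rational_formula p
  end.

Lemma parameter_free_rational_term t :
  parameter_free_term t -> rational_term t.
Proof.
by elim: t => //= t1 IH1 t2 IH2 /andP[/IH1 -> /IH2 ->].
Qed.

Lemma parameter_free_rational f : parameter_free f -> rational_formula f.
Proof.
elim: f => //=; do ?[by move=> t1 t2 /andP[? ?];
  rewrite !parameter_free_rational_term].
all: by move=> f1 IH1 f2 IH2 /andP[/IH1 -> /IH2 ->].
Qed.

Lemma rational_rterm t : rational_term t -> GRing.rterm t.
Proof.
by elim: t => //= t1 IH1 t2 IH2 /andP[/IH1 -> /IH2 ->].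
Qed.

Lemma rational_rformula f : rational_formula f -> ord.rformula f.
Proof.
elim: f => //=; do ?[by move=> t1 t2 /andP[? ?]; rewrite !rational_rterm].
all: by move=> f1 IH1 f2 IH2 /andP[/IH1 -> /IH2 ->].
Qed.

Lemma rational_int (z : int) : rational_number z%:~R.
Proof. by apply/asboolP; exists z%:~R; rewrite ratr_int. Qed.

Lemma rational0 : rational_number 0.
Proof. exact: (rational_int 0). Qed.

Lemma rationalN1 : rational_number (- 1).
Proof. exact: (rational_int (- 1)). Qed.

(** * Rationality through the procedures of the elimination *)

Import qe_rcf.
Import (canonicals) ord.

Local Notation rt := (fun t : term R => rational_term (rterm_to_term t)).
Local Notation rf f := (rational_formula (qfr_to_formula f)).
Local Notation rp := (all rt).

(** The procedures hand their results to a continuation [k]. Here and below, the hypothesis on [k]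
    says that it turns rational data into a rational formula, so the lemmas compose exactly as the
    procedures do. *)
Lemma rational_Size p k :
  rp p -> (forall n, rf (k n)) -> rf (Size p k).
Proof.
elim: p k => [|c p IH] k //= /andP[rc rpp] rk; apply: IH => // -[|n] //=.
by rewrite rc !rk.
Qed.

Lemma rational_Isnull p k :
  rp p -> (forall n, rf (k n)) -> rf (Isnull p k).
Proof. by move=> rpp rk; apply: rational_Size. Qed.

Lemma rational_LeadCoef p k :
  rp p -> (forall l, rt l -> rf (k l)) -> rf (LeadCoef p k).
Proof.
elim: p k => [|c p IH] k /= => [_ rk|/andP[rc rpp] rk].
  by apply: rk; rewrite /= rational0.
by apply: IH => // l rl /=; rewrite rl !rk.
Qed.

Lemma rational_AmulXn a n : rt a -> rp (AmulXn a n).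
Proof. by move=> ra; elim: n => [|n IH] /=; rewrite ?ra ?rational0. Qed.

Lemma rational_AddPoly p q : rp p -> rp q -> rp (AddPoly p q).
Proof.
elim: p q => [|a p IH] [|b q] //= /andP[ra rpp] /andP[rb rq].
by rewrite ra rb IH.
Qed.

Lemma rational_ScalPoly a p : rt a -> rp p -> rp (ScalPoly a p).
Proof.
by move=> ra; rewrite all_map; apply: sub_all => t rtt /=; rewrite ra.
Qed.

Lemma rational_MulPoly p q : rp p -> rp q -> rp (MulPoly p q).
Proof.
elim: p => [|a p IH] //= /andP[ra rpp] rq.
by apply: rational_AddPoly; rewrite /= ?IH ?rational_ScalPoly.
Qed.

Lemma rational_ExpPoly p n : rp p -> rp (ExpPoly p n).
Proof.
move=> rpp; rewrite /ExpPoly; case: n => [|n] //; rewrite iteropS.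
by elim: n => //= n IH; apply: rational_MulPoly.
Qed.

Lemma rational_OppPoly p : rp p -> rp (OppPoly p).
Proof. by apply: rational_ScalPoly => /=; exact: rationalN1. Qed.

Lemma rational_Deriv p : rp p -> rp (Deriv p).
Proof.
elim: p => //= a p IH /andP[ra rpp].
by apply: rational_AddPoly => //=; exact: IH.
Qed.

Lemma rational_Rediv_rec_loop q sq cq c qq r n k :
  rp q -> rt cq -> rp qq -> rp r ->
  (forall c qq r, rp qq -> rp r -> rf (k (c, qq, r))) ->
  rf (Rediv_rec_loop q sq cq c qq r n k).
Proof.
move=> rq rcq + + rk; elim: n c qq r => [|n IH] c qq r rqq rr /=;
  apply: rational_Size => // sr; case: ifP => _; try exact: rk;
  apply: rational_LeadCoef => // l rl;
  have rm := rational_AmulXn (sr - sq) rl; by [apply: rk; rewrite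
    ?rational_AddPoly ?rational_OppPoly ?rational_MulPoly //= rcq |
  apply: IH; rewrite
    ?rational_AddPoly ?rational_OppPoly ?rational_MulPoly //= rcq].
Qed.

Lemma rational_Rediv p q k :
  rp p -> rp q -> (forall c qq r, rp qq -> rp r -> rf (k (c, qq, r))) ->
  rf (Rediv p q k).
Proof.
move=> rpp rq rk; apply: rational_Isnull => // -[].
  by apply: rk => //=; rewrite rational0.
apply: rational_Size => // sq; apply: rational_Size => // sp.
apply: rational_LeadCoef => // l rl; apply: rational_Rediv_rec_loop => //=.
by rewrite rational0.
Qed.

Lemma rational_NextMod p q k :
  rp p -> rp q -> (forall r, rp r -> rf (k r)) -> rf (NextMod p q k).
Proof.
move=> rpp rq rk; apply: rational_LeadCoef => // l rl.
apply: rational_Rediv => // c ? ? ? ?; apply: rational_Rediv => // ? ? r ? rr.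
by apply: rk; apply: rational_ScalPoly.
Qed.

Lemma rational_Rgcd_loop n p q k :
  rp p -> rp q -> (forall r, rp r -> rf (k r)) -> rf (Rgcd_loop n p q k).
Proof.
elim: n p q => [|n IH] p q rpp rq rk /=; apply: rational_Rediv => // ? ? r ? rr;
  apply: rational_Isnull => // -[]; by [apply: rk | apply: IH].
Qed.

Lemma rational_Rgcd p q k :
  rp p -> rp q -> (forall r, rp r -> rf (k r)) -> rf (Rgcd p q k).
Proof.
move=> rpp rq rk; apply: rational_Size => // n; apply: rational_Size => // m.
case: ltnP => _; apply: rational_Isnull => // -[]; try exact: rk;
  by apply: rational_Size => // s; apply: rational_Rgcd_loop.
Qed.

Lemma rational_BigRgcd ps k :
  all rp ps -> (forall r, rp r -> rf (k r)) -> rf (BigRgcd ps k).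
Proof.
elim: ps k => [|p ps IH] k /= => [_ rk|/andP[rpp rps] rk].
  by apply: rk; rewrite /= rational0.
by apply: IH => // r rr; apply: rational_Rgcd.
Qed.

Lemma rational_Changes s k :
  rp s -> (forall n, rf (k n)) -> rf (Changes s k).
Proof.
elim: s k => [|a s IH] k //= /andP[ra rs] rk; apply: IH => // n /=.
by rewrite ra !rk !andbT; case: s rs => [|b s] //= /andP[->].
Qed.

Lemma rational_SeqPInfty ps k :
  all rp ps -> (forall r, rp r -> rf (k r)) -> rf (SeqPInfty ps k).
Proof.
elim: ps k => [|p ps IH] k /= => [_|/andP[rpp rps]] rk; first exact: rk.
apply: rational_LeadCoef => // l rl; apply: IH => // r rr.
by apply: rk; rewrite /= rl.
Qed.

Lemma rational_SeqMInfty ps k :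
  all rp ps -> (forall r, rp r -> rf (k r)) -> rf (SeqMInfty ps k).
Proof.
elim: ps k => [|p ps IH] k /= => [_|/andP[rpp rps]] rk; first exact: rk.
apply: rational_LeadCoef => // l rl; apply: rational_Size => // n.
by apply: IH => // r rr; apply: rk; rewrite /= rl rationalN1.
Qed.

Lemma rational_ChangesPoly ps k :
  all rp ps -> (forall n, rf (k n)) -> rf (ChangesPoly ps k).
Proof.
move=> rps rk; apply: rational_SeqMInfty => // m rm.
apply: rational_SeqPInfty => // p rpp; apply: rational_Changes => // vm.
exact: rational_Changes.
Qed.

Lemma rational_ModsAux p q n k :
  rp p -> rp q -> (forall r, all rp r -> rf (k r)) -> rf (ModsAux p q n k).
Proof.
elim: n p q k => [|n IH] p q k rpp rq rk /=; first exact: rk.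
apply: rational_Isnull => // -[]; first exact: rk.
apply: rational_NextMod => // r rr; apply: IH => // s rs.
by apply: rk; rewrite /= rpp.
Qed.

Lemma rational_PolyComb sq sc : all rp sq -> rp (PolyComb sq sc).
Proof.
move=> rsq; rewrite /PolyComb; elim: (iota _ _) => //= i s IH.
apply: rational_MulPoly => //; apply: rational_ExpPoly.
have [ilt|ige] := ltnP i (size sq); last by rewrite nth_default.
exact: (all_nthP [::] rsq).
Qed.

Lemma rational_Pcq sq i : all rp sq -> rp (Pcq sq i).
Proof.
move=> rsq; rewrite /Pcq.
have [ilt|ige] := ltnP i (size (qe_rcf_th.sg_tab (size sq))).
  by rewrite (nth_map [::]) // rational_PolyComb.
by rewrite nth_default ?size_map.
Qed.

Lemma rational_TaqsR p sq i k :
  rp p -> all rp sq -> (forall t, rt t -> rf (k t)) -> rf (TaqsR p sq i k).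
Proof.
move=> rpp rsq rk; apply: rational_Size => // m; apply: rational_Size => [|n].
  by rewrite rational_MulPoly ?rational_Deriv ?rational_Pcq.
apply: rational_ModsAux => // [|s rs].
  by rewrite rational_MulPoly ?rational_Deriv ?rational_Pcq.
by apply: rational_ChangesPoly => // z; apply: rk; rewrite /= rational_int.
Qed.

(** The coefficients are entries of the inverse of an integer matrix, and matrix inversion commutes
    with the embedding of [rat]. Indices out of range give 0 on both sides. *)
Lemma ratr_coefs n i : qe_rcf_th.coefs R n i = ratr (qe_rcf_th.coefs rat n i).
Proof.
rewrite /qe_rcf_th.coefs; set M := qe_rcf_th.ctmat n.
have -> : invmx (map_mx (intmul 1 : int -> R) M) =
    map_mx ratr (invmx (map_mx (intmul 1 : int -> rat) M)).
  rewrite map_invmx; congr invmx; apply/matrixP => a b.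
  by rewrite !mxE /= ratr_int.
move: (enum (ordinal _)) => s; have [ilt|ige] := ltnP i (size s); last first.
  by rewrite !nth_default ?size_map // (ratr_nat _ 0).
have x0 : 'I_(3 ^ n) by case: s ilt.
by rewrite !(nth_map x0) // !castmxE mxE.
Qed.

Lemma rational_Coefs n i : rt (Coefs R n i).
Proof.
case: n => [|[|n]] /=; first exact: (rational_int (i == 0)%N).
  have r2 : rational_number 2^-1.
    by apply/asboolP; exists 2^-1; rewrite fmorphV /= ratr_nat.
  by case: i => [|[|[|i]]] //=; rewrite ?nth_nil rational0.
by apply/asboolP; rewrite ratr_coefs; eexists.
Qed.

Lemma rational_CcountWeak p sq k :
  rp p -> all rp sq -> (forall t, rt t -> rf (k t)) -> rf (CcountWeak p sq k).
Proof.
move=> rpp rsq rk; rewrite /CcountWeak.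
have : rt (NatConst R 0) by [].
move: (NatConst R 0); elim: (3 ^ size sq)%N => [|n IH] s rs; first exact: rk.
apply: rational_TaqsR => // t rtt; apply: IH => /=.
by rewrite rtt rs !andbT; exact: rational_Coefs.
Qed.

Lemma rational_BoundingPoly sq : all rp sq -> rp (BoundingPoly sq).
Proof.
move=> rsq; apply: rational_Deriv; elim: sq rsq => //= p sq IH /andP[rpp /IH].
exact: rational_MulPoly.
Qed.

Lemma rational_CcountGt0 sp sq :
  all rp sp -> all rp sq -> rf (CcountGt0 sp sq).
Proof.
move=> rsp rsq; apply: rational_BigRgcd => // p rpp.
apply: rational_Isnull => // -[] /=; last first.
  by apply: rational_CcountWeak.
apply: rational_CcountWeak => // [|t rtt /=]; first exact: rational_BoundingPoly.
rewrite rtt andbT; apply/andP; split.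
  elim: sq rsq => //= q sq IH /andP[rq /IH ->]; rewrite andbT.
  exact: rational_LeadCoef.
elim: sq rsq => //= q sq IH /andP[rq /IH ->]; rewrite andbT.
by apply: rational_Size => // n; apply: rational_LeadCoef.
Qed.

Lemma rational_abstrX i t : rt t -> rp (abstrX i t).
Proof.
elim: t => //=.
- by move=> n _; case: ifP.
- by move=> c ->.
- by move=> t1 IH1 t2 IH2 /andP[/IH1 ? /IH2 ?]; apply: rational_AddPoly.
- by move=> t1 IH1 /IH1; apply: rational_OppPoly.
- by move=> t1 IH1 n /IH1; apply: rational_ScalPoly.
- by move=> t1 IH1 t2 IH2 /andP[/IH1 ? /IH2 ?]; apply: rational_MulPoly.
- by move=> t1 IH1 n /IH1; apply: rational_ExpPoly.
Qed.

Lemma rational_wproj n (s : seq (GRing.term R) * seq (GRing.term R)) :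
  all rational_term s.1 -> all rational_term s.2 -> rf (wproj n s).
Proof.
case: s => s1 s2 /= r1 r2; apply: rational_CcountGt0; rewrite all_map.
  apply: sub_all r1 => t rtt /=; apply: rational_abstrX.
  by rewrite to_rtermE // rational_rterm.
apply: sub_all r2 => t rtt /=; apply: rational_abstrX.
by rewrite to_rtermE // rational_rterm.
Qed.

Definition rational_oclause (c : ord.oclause R) : bool :=
  all rational_term (ord.terms_of_oclause c).

Lemma rational_proj n c :
  rational_oclause c ->
  rational_formula (ord.proj (fun i s => wproj i s) n c).
Proof.
move=> rc; rewrite /ord.proj /ord.oclause_to_w.
(* Removing disequalities and weak inequalities from a clause creates only terms already present and
   opposites of such terms. *)
have : all rational_oclause (ord.oclause_neq_leq_elim c).
  apply/allP => c' /ord.terms_of_neq_leq_elim sub.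
  rewrite /rational_oclause in rc *; apply/allP => t /sub.
  rewrite mem_cat => /orP[/(allP rc) //|].
  move=> /mapP[u u2 ->] /=; apply: (allP rc).
  by case: c u2 {rc sub} => a b d e /= ub; rewrite !mem_cat ub orbT.
elim: (ord.oclause_neq_leq_elim c) => //= -[a b d e] l IH /= /andP[r1 /IH ->].
rewrite andbT; move: r1; rewrite /rational_oclause /= !all_cat.
by case/and4P => *; apply: rational_wproj.
Qed.

Lemma rational_qf_to_odnf f b :
  rational_formula f -> all rational_oclause (ord.qf_to_odnf f b).
Proof.
have cat_ok s1 s2 : all rational_oclause s1 -> all rational_oclause s2 ->
    all rational_oclause (s1 ++ s2) by rewrite all_cat => -> ->.
have and_ok s1 s2 : all rational_oclause s1 -> all rational_oclause s2 ->
    all rational_oclause (ord.and_odnf s1 s2).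
  move=> r1 r2; rewrite /ord.and_odnf; elim: s1 r1 => [|c s1 IH] /=.
    by rewrite big_nil.
  rewrite big_cons => /andP[rc /IH ?]; apply: cat_ok => //.
  rewrite all_map; apply: sub_all r2 => -[a2 b2 c2 d2].
  case: c rc => a1 b1 c1 d1; rewrite /rational_oclause /= !all_cat.
  by case/and4P => -> -> -> -> /and4P[-> -> -> ->].
rewrite /rational_oclause in cat_ok and_ok *.
elim: f b => //=.
- by move=> [] [].
- by move=> t1 t2 [] /=; rewrite !andbT.
- by move=> t1 t2 [] /= /andP[-> ->].
- by move=> t1 t2 [] /= /andP[-> ->].
- by move=> f1 IH1 f2 IH2 [] /andP[/IH1 ? /IH2 ?]; auto.
- by move=> f1 IH1 f2 IH2 [] /andP[/IH1 ? /IH2 ?]; auto.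
- by move=> f1 IH1 f2 IH2 [] /andP[/IH1 ? /IH2 ?]; auto.
- by move=> f1 IH1 b /IH1.
- by move=> n f1 IH1 [].
- by move=> n f1 IH1 [].
Qed.

Definition rcf_elim : ord.formula R -> ord.formula R :=
  ord.quantifier_elim (fun i s => wproj i s).

Lemma rational_rcf_elim f :
  rational_formula f -> rational_formula (rcf_elim f).
Proof.
have elim_ok n g b : rational_formula g -> rational_formula
    (foldr (@ord.Or R) (ord.Bool false)
      [seq ord.proj (fun i s => wproj i s) n c | c <- ord.qf_to_odnf g b]).
  move=> /(rational_qf_to_odnf b); elim: (ord.qf_to_odnf _ _) => //= c s IH.
  by move=> /andP[rc /IH ->]; rewrite rational_proj.
rewrite /rcf_elim; elim: f => //=.
- by move=> f1 IH1 f2 IH2 /andP[/IH1 -> /IH2 ->].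
- by move=> f1 IH1 f2 IH2 /andP[/IH1 -> /IH2 ->].
- by move=> f1 IH1 f2 IH2 /andP[/IH1 -> /IH2 ->].
- by move=> n f1 IH1 /IH1; apply: elim_ok.
- by move=> n f1 IH1 /IH1 ?; apply: elim_ok.
Qed.

Lemma rcf_elim_qf f : rational_formula f -> ord.qf_form (rcf_elim f).
Proof.
move=> /rational_rformula rff.
by have /andP[] := ord.quantifier_elim_wf (@wf_QE_wproj R) rff.
Qed.

Lemma rcf_elimP e f :
  rational_formula f -> ord.holds e (rcf_elim f) <-> ord.holds e f.
Proof.
move=> rff; have rr := rational_rformula rff.
have := ord.quantifier_elim_rformP (@wf_QE_wproj R) (@valid_QE_wproj R) e rr.
move=> /rwP ->; split; first by move/(ord.qf_evalP _ (rcf_elim_qf rff)).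
by move/(ord.qf_evalP _ (rcf_elim_qf rff)).
Qed.

End RationalQE.

(** * Definable predicates *)

Section Definable.

Variable R : rcfType.
Implicit Types (e : seq R) (P Q : seq R -> Prop).

Fixpoint subst_term (s : nat -> GRing.term R) (t : GRing.term R) :=
  match t with
  | GRing.Var i => s i
  | GRing.Const _ | GRing.NatConst _ => t
  | GRing.Add t1 t2 => GRing.Add (subst_term s t1) (subst_term s t2)
  | GRing.Opp t1 => GRing.Opp (subst_term s t1)
  | GRing.NatMul t1 n => GRing.NatMul (subst_term s t1) n
  | GRing.Mul t1 t2 => GRing.Mul (subst_term s t1) (subst_term s t2)
  | GRing.Inv t1 => GRing.Inv (subst_term s t1)
  | GRing.Exp t1 n => GRing.Exp (subst_term s t1) n
  end.

(* Only meant for quantifier-free formulas: quantifiers are left alone. *)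
Fixpoint subst_formula (s : nat -> GRing.term R) (f : ord.formula R) :=
  match f with
  | ord.Equal t1 t2 => ord.Equal (subst_term s t1) (subst_term s t2)
  | ord.Lt t1 t2 => ord.Lt (subst_term s t1) (subst_term s t2)
  | ord.Le t1 t2 => ord.Le (subst_term s t1) (subst_term s t2)
  | ord.Unit t1 => ord.Unit (subst_term s t1)
  | ord.And f1 f2 => ord.And (subst_formula s f1) (subst_formula s f2)
  | ord.Or f1 f2 => ord.Or (subst_formula s f1) (subst_formula s f2)
  | ord.Implies f1 f2 => ord.Implies (subst_formula s f1) (subst_formula s f2)
  | ord.Not f1 => ord.Not (subst_formula s f1)
  | _ => f
  end.

Lemma eval_subst_term s e e' t :
  (forall i, GRing.eval e (s i) = e'`_i) ->
  GRing.eval e (subst_term s t) = GRing.eval e' t.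
Proof. by move=> se; elim: t => //=; do ?[move=> ? -> | move=> ?]. Qed.

Lemma holds_subst_formula s e e' f :
  (forall i, GRing.eval e (s i) = e'`_i) -> ord.qf_form f ->
  ord.holds e (subst_formula s f) <-> ord.holds e' f.
Proof.
move=> se; elim: f => //=; do ?[by move=> *; rewrite !(eval_subst_term _ se)].
- by move=> f1 IH1 f2 IH2 /andP[/IH1 -> /IH2 ->].
- by move=> f1 IH1 f2 IH2 /andP[/IH1 -> /IH2 ->].
- by move=> f1 IH1 f2 IH2 /andP[/IH1 -> /IH2 ->].
- by move=> f1 IH1 /IH1 ->.
Qed.

Lemma rational_subst_term s t :
  (forall i, rational_term (s i)) -> rational_term t ->
  rational_term (subst_term s t).
Proof.
by move=> rs; elim: t => //= t1 IH1 t2 IH2 /andP[/IH1 -> /IH2 ->].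
Qed.

Lemma rational_subst_formula s f :
  (forall i, rational_term (s i)) -> rational_formula f ->
  rational_formula (subst_formula s f).
Proof.
move=> rs; elim: f => //=; do ?[by move=> t1 t2 /andP[? ?];
  rewrite !rational_subst_term].
all: by move=> f1 IH1 f2 IH2 /andP[/IH1 -> /IH2 ->].
Qed.

(** Only environments of length exactly [n] are constrained, so variable [n] is fresh and
    quantifying it amounts to appending an entry. *)
Definition definable (n : nat) P : Prop :=
  exists2 f : ord.formula R, rational_formula f &
    forall e, size e = n -> P e <-> ord.holds e f.

(** Substitution, the sign analysis on cusps and evaluation at rational points all work on
    quantifier-free formulas only; this is where elimination enters. *)
Lemma definable_qf n P : definable n P ->
  exists f : ord.formula R, [/\ rational_formula f, ord.qf_form f &
    forall e, size e = n -> P e <-> ord.holds e f].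
Proof.
move=> [f rf Pf]; exists (rcf_elim f); split.
- exact: rational_rcf_elim.
- exact: rcf_elim_qf.
- by move=> e se; rewrite Pf // rcf_elimP.
Qed.

Lemma eq_definable n P Q :
  (forall e, size e = n -> P e <-> Q e) -> definable n P -> definable n Q.
Proof. by move=> PQ [f rf Pf]; exists f => // e se; rewrite -PQ // Pf. Qed.

Lemma definable_lt n (t1 t2 : GRing.term R) :
  rational_term t1 -> rational_term t2 ->
  definable n (fun e => GRing.eval e t1 < GRing.eval e t2).
Proof. by move=> r1 r2; exists (ord.Lt t1 t2) => //=; rewrite r1. Qed.

Lemma definable_and n P Q :
  definable n P -> definable n Q -> definable n (fun e => P e /\ Q e).
Proof.
move=> [f rf Pf] [g rg Qg]; exists (ord.And f g) => /= [|e se].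
  by rewrite rf.
by rewrite Pf // Qg.
Qed.

Lemma definable_imply n P Q :
  definable n P -> definable n Q -> definable n (fun e => P e -> Q e).
Proof.
move=> [f rf Pf] [g rg Qg]; exists (ord.Implies f g) => /= [|e se].
  by rewrite rf.
by rewrite Pf // Qg.
Qed.

Lemma definable_not n P : definable n P -> definable n (fun e => ~ P e).
Proof. by move=> [f rf Pf]; exists (ord.Not f) => //= e se; rewrite Pf. Qed.

Lemma definable_ex n P :
  definable n.+1 P -> definable n (fun e => exists x, P (rcons e x)).
Proof.
move=> [f rf Pf]; exists (ord.Exists n f) => //= e se.
(* The semantics of a quantifier overwrites entry [n]; on a list of length [n] this appends. *)
have E x : set_nth 0 e n x = rcons e x by rewrite -se -cats1 set_nthE ltnn subnn.
split=> -[x] => [|]; last rewrite E.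
  by rewrite Pf ?size_rcons ?se // => Px; exists x; rewrite E.
by rewrite -Pf ?size_rcons ?se // => Px; exists x.
Qed.

Lemma definable_all n P :
  definable n.+1 P -> definable n (fun e => forall x, P (rcons e x)).
Proof.
move=> /definable_not/definable_ex/definable_not; apply: eq_definable => e se.
split=> [H x|H [x]]; last by apply.
by apply: contrapT => Px; apply: H; exists x.
Qed.

Lemma definable_allord n k (P : 'I_k -> seq R -> Prop) :
  (forall i, definable n (P i)) -> definable n (fun e => forall i, P i e).
Proof.
move=> /= dP; suff dl (l : seq 'I_k) :
    definable n (fun e => forall i, i \in l -> P i e).
  apply: eq_definable (dl (enum 'I_k)) => e _.
  by split=> H i; [apply: H; rewrite mem_enum | move=> _; apply: H].
elim: l => [|j l IH]; first by exists (ord.Bool true).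
apply: eq_definable (definable_and (dP j) IH) => e _.
split=> [[Pj Pl] i|H].
  by rewrite inE => /predU1P[-> //|]; apply: Pl.
by split=> [|i il]; apply: H; rewrite inE ?eqxx ?il ?orbT.
Qed.

Definition row_seq n (x : 'rV[R]_n) : seq R := [seq x 0 i | i <- enum 'I_n].

Lemma size_row_seq n (x : 'rV[R]_n) : size (row_seq x) = n.
Proof. by rewrite size_map size_enum_ord. Qed.

Lemma nth_row_seq n (x : 'rV[R]_n) (i : 'I_n) : (row_seq x)`_i = x 0 i.
Proof. by rewrite (nth_map i) ?size_enum_ord // nth_ord_enum. Qed.

Lemma row_seq_surj (s : seq R) : exists x : 'rV_(size s), row_seq x = s.
Proof.
exists (\row_i s`_i); apply: (@eq_from_nth _ 0); rewrite ?size_row_seq //.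
by move=> i ilt; rewrite (nth_row_seq _ (Ordinal ilt)) mxE.
Qed.

Lemma definable_allrow n k P :
  definable (n + k) P ->
  definable n (fun e => forall x : 'rV_k, P (e ++ row_seq x)).
Proof.
(* Rows are replaced by lists of length [k], from which the induction on [k] can peel off the first
   entry. *)
move=> dP; suff : definable n (fun e => forall s, size s = k -> P (e ++ s)).
  apply: eq_definable => e _; split=> H.
    by move=> x; apply: H; rewrite size_row_seq.
  by move=> s sk; have [x <-] := row_seq_surj s; move: x; rewrite sk => x.
elim: k n P dP => [|k IH] n P dP.
  rewrite addn0 in dP; apply: eq_definable dP => e _; split=> [Pe s /size0nil ->|].
    by rewrite cats0.
  by move=> /(_ [::] erefl); rewrite cats0.
rewrite addnS -addSn in dP; apply: eq_definable (definable_all (IH _ _ dP)) => e _.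
split=> [H [|x s] //= [/(H x)]|H x s sk]; rewrite cat_rcons //.
by apply: H; rewrite /= sk.
Qed.

Lemma definable_slice n j k P :
  definable k P -> (j + k <= n)%N -> definable n (fun e => P (take k (drop j e))).
Proof.
move=> /definable_qf[f [rf qf Pf]] jkn.
(* The formula may mention variables from [k] on. They read as 0 in the slice but could hit actual
   entries of [e] after the shift, hence the constant 0. *)
pose s i : GRing.term R :=
  if (i < k)%N then GRing.Var R (j + i) else GRing.NatConst R 0.
exists (subst_formula s f).
  by apply: rational_subst_formula => // i; rewrite /s; case: ifP.
move=> e se; rewrite Pf; last first.
  by rewrite size_takel // size_drop se leq_subRL // (leq_trans (leq_addr _ _) jkn).
rewrite (@holds_subst_formula s e (take k (drop j e))) // => i.
rewrite /s; case: ltnP => ik /=.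
  by rewrite nth_take // nth_drop.
by rewrite nth_default // (leq_trans _ ik) // size_take_min geq_minl.
Qed.

End Definable.

(** * Signs of bivariate polynomials on a cusp *)

Section PolynomialGrowth.

Variable R : rcfType.

(** The inequality [d * E ^+ k <= 1] is [d <= E^-k] without an inverse. Since [1 <= C], raising [k]
    shrinks the cusp, so two cusps always contain a common one. *)
Definition cusp_near (Q : R -> R -> Prop) : Prop :=
  exists (k : nat) (C : R), 1 <= C /\
    forall E d, C <= E -> 0 < d -> d * E ^+ k <= 1 -> Q E d.

Lemma cusp_near_and Q1 Q2 : cusp_near Q1 -> cusp_near Q2 ->
  cusp_near (fun E d => Q1 E d /\ Q2 E d).
Proof.
move=> [k1 [C1 [C1ge1 H1]]] [k2 [C2 [C2ge1 H2]]].
exists (k1 + k2)%N, (Num.max C1 C2); split; first by rewrite le_max C1ge1.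
move=> E d; rewrite ge_max => /andP[E1 E2] d0 dE.
have Ege1 : 1 <= E by rewrite (le_trans C1ge1).
have H k : (k <= k1 + k2)%N -> d * E ^+ k <= 1.
  by move=> kle; apply: le_trans dE; rewrite ler_pM2l // ler_weXn2l.
by split; [apply: H1 | apply: H2] => //; apply: H; rewrite ?leq_addr ?leq_addl.
Qed.

Lemma cusp_near_mono (Q1 Q2 : R -> R -> Prop) :
  (forall E d, 1 <= E -> 0 < d -> Q1 E d -> Q2 E d) ->
  cusp_near Q1 -> cusp_near Q2.
Proof.
move=> Q12 [k [C [C1 H]]]; exists k, C; split=> // E d CE d0 dE.
by apply: Q12 => //; [apply: le_trans C1 CE | apply: H].
Qed.

Lemma poly_growth (c : {poly R}) :
  exists (M : R) (k : nat), 0 <= M /\ forall E, 1 <= E -> `|c.[E]| <= M * E ^+ k.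
Proof.
elim/poly_ind: c => [|p a [M [k [M0 IH]]]].
  by exists 0, 0%N; split=> // E _; rewrite horner0 normr0 mul0r.
exists (M + `|a|), k.+1; split=> [|E E1]; first by rewrite addr_ge0.
have E0 : 0 <= E by rewrite (le_trans ler01).
rewrite hornerMXaddC (le_trans (ler_normD _ _)) // mulrDl lerD //.
  by rewrite normrM (ger0_norm E0) exprSr mulrA ler_wpM2r // IH.
by rewrite ler_peMr // exprn_ege1.
Qed.

(** The outer indeterminate stands for [d] and the coefficients are polynomials in [E]. As [d <= 1],
    a factor [d] only decreases the bound. *)
Lemma bipoly_growth (p : {poly {poly R}}) :
  exists (M : R) (k : nat), 0 <= M /\ forall E d, 1 <= E -> 0 < d -> d <= 1 ->
    `|p.[d%:P].[E]| <= M * E ^+ k.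
Proof.
elim/poly_ind: p => [|p c [M [k [M0 IH]]]].
  by exists 0, 0%N; split=> // E *; rewrite !horner0 normr0 mul0r.
have [M' [k' [M'0 H]]] := poly_growth c.
exists (M + M'), (k + k')%N; split=> [|E d E1 d0 d1]; first by rewrite addr_ge0.
rewrite hornerMXaddC hornerD hornerM hornerC.
rewrite (le_trans (ler_normD _ _)) // mulrDl lerD //.
  rewrite normrM (gtr0_norm d0) (le_trans (ler_piMr _ d1)) //.
  by rewrite (le_trans (IH _ _ E1 d0 d1)) // ler_wpM2l // ler_weXn2l // leq_addr.
by rewrite (le_trans (H _ E1)) // ler_wpM2l // ler_weXn2l // leq_addl.
Qed.

Lemma sgr_near (a b : R) : `|b| < `|a| -> Num.sg (a + b) = Num.sg a.
Proof.
move=> ba; have [a0|a0|a0] := ltrgt0P a.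
- by rewrite (gtr0_norm a0) in ba; rewrite !gtr0_sg //; move: ba; rewrite ltr_norml; lra.
- by rewrite (ltr0_norm a0) in ba; rewrite !ltr0_sg //; move: ba; rewrite ltr_norml; lra.
- by rewrite a0 normr0 normr_lt0 in ba.
Qed.

(* Writing p(E,d) = c(E) + d q(E,d) with c <> 0, the first term dominates as soon
   as d is smaller than a large negative power of E. *)
Lemma bipoly_sign (p : {poly {poly R}}) :
  exists s : R, cusp_near (fun E d => Num.sg p.[d%:P].[E] = s).
Proof.
elim/poly_ind: p => [|q c [s IH]].
  by exists 0, 0%N, 1; split=> // E d *; rewrite !horner0 sgr0.
(* If [c = 0], then [p = d q], and the positive factor [d] leaves the sign of [q] unchanged. *)
have [c0|c0] := eqVneq c 0.
  exists s; apply: cusp_near_mono IH => E d _ d0 <-.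
  by rewrite c0 addr0 hornerMX hornerM hornerC sgrM (gtr0_sg d0) mulr1.
have [C csg] : exists C, forall E, C <= E ->
    Num.sg c.[E] = Num.sg (lead_coef c) /\ `|lead_coef c| <= `|c.[E]|.
  have lc0 : lead_coef c != 0 by rewrite lead_coef_eq0.
  have [l0|l0|l0] := ltrgt0P (lead_coef c); last by rewrite l0 eqxx in lc0.
    have [C H] := poly_pinfty_gt_lc l0; exists C => E /H {}H.
    have cE : 0 < c.[E] by rewrite (lt_le_trans l0).
    by rewrite !gtr0_sg // !gtr0_norm.
  have l0' : 0 < lead_coef (- c) by rewrite lead_coefN oppr_gt0.
  have [C H] := poly_pinfty_gt_lc l0'; exists C => E /H {H}.
  rewrite lead_coefN hornerN lerN2 => H.
  have cE : c.[E] < 0 by rewrite (le_lt_trans H).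
  by rewrite !ltr0_sg // !ltr0_norm // lerN2.
have [M [k [M0 H]]] := bipoly_growth q.
set l := `|lead_coef c| in csg.
have l0 : 0 < l by rewrite normr_gt0 lead_coef_eq0.
(* The perturbation is at most [M * E ^+ k * d]. Multiplied by [E] it is at most [M] on the cusp of
   exponent [k + 1], and [M < l * E] because [E >= M / l + 1]; so it stays below [l]. *)
exists (Num.sg (lead_coef c)), k.+1, (Num.max 1 (Num.max C (M / l + 1))).
split; first by rewrite le_max lexx.
move=> E d; rewrite !ge_max => /and3P[E1 CE ME] d0 dE.
have [<- cl] := csg _ CE.
have Egt0 : 0 < E by rewrite (lt_le_trans ltr01).
rewrite hornerMXaddC hornerD hornerM hornerC addrC sgr_near //.
apply: lt_le_trans cl.
have d1 : d <= 1.
  by apply: le_trans dE; rewrite ler_peMr ?exprn_ege1 // ltW.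
rewrite normrM (gtr0_norm d0) (le_lt_trans (ler_wpM2r (ltW d0) (H _ _ E1 d0 d1))) //.
have {}ME : M < l * E.
  by rewrite -ltr_pdivrMl // mulrC (lt_le_trans _ ME) // ltrDl.
rewrite -(ltr_pM2r Egt0) (le_lt_trans _ ME) // -!mulrA ler_piMr //.
by rewrite mulrC -mulrA -exprS.
Qed.

(** Variable 0 becomes the inner indeterminate and variable 1 the outer one; every further variable
    reads as 0. *)
Lemma eval_bipoly (t : GRing.term R) : GRing.rterm t ->
  exists p : {poly {poly R}},
    forall E d, GRing.eval [:: E; d] t = p.[d%:P].[E].
Proof.
elim: t => //=.
- case=> [|[|i]] _; [exists 'X%:P | exists 'X | exists 0] => E d /=.
  + by rewrite hornerC hornerX.
  + by rewrite hornerX hornerC.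
  + by rewrite nth_nil !horner0.
- by move=> c _; exists c%:P%:P => E d; rewrite !hornerC.
- by move=> n _; exists n%:R%:P%:P => E d; rewrite !hornerC.
- move=> t1 IH1 t2 IH2 /andP[/IH1[p1 E1] /IH2[p2 E2]].
  by exists (p1 + p2) => E d; rewrite E1 E2 !hornerD.
- by move=> t1 IH1 /IH1[p1 E1]; exists (- p1) => E d; rewrite E1 !hornerN.
- by move=> t1 IH1 n /IH1[p1 E1]; exists (p1 *+ n) => E d; rewrite E1 !hornerMn.
- move=> t1 IH1 t2 IH2 /andP[/IH1[p1 E1] /IH2[p2 E2]].
  by exists (p1 * p2) => E d; rewrite E1 E2 !hornerM.
- by move=> t1 IH1 n /IH1[p1 E1]; exists (p1 ^+ n) => E d; rewrite E1 !horner_exp.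
Qed.

Lemma term_sign (t1 t2 : GRing.term R) : GRing.rterm t1 -> GRing.rterm t2 ->
  exists s : R, cusp_near (fun E d =>
    Num.sg (GRing.eval [:: E; d] t1 - GRing.eval [:: E; d] t2) = s).
Proof.
move=> /eval_bipoly[p1 E1] /eval_bipoly[p2 E2].
have [s H] := bipoly_sign (p1 - p2); exists s.
by apply: cusp_near_mono H => E d _ _ <-; rewrite E1 E2 !hornerD !hornerN.
Qed.

Lemma cusp_near_qf (f : ord.formula R) : ord.qf_form f -> ord.rformula f ->
  exists b : bool, cusp_near (fun E d => ord.qf_eval [:: E; d] f = b).
Proof.
elim: f => //=.
- by move=> b _ _; exists b, 0%N, 1.
- move=> t1 t2 _ /andP[r1 r2]; have [s H] := term_sign r1 r2.
  exists (s == 0); apply: cusp_near_mono H => E d _ _ <-.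
  by rewrite sgr_eq0 subr_eq0.
- move=> t1 t2 _ /andP[r1 r2]; have [s H] := term_sign r1 r2.
  exists (s < 0); apply: cusp_near_mono H => E d _ _ <-.
  by rewrite sgr_lt0 subr_lt0.
- move=> t1 t2 _ /andP[r1 r2]; have [s H] := term_sign r1 r2.
  exists (s <= 0); apply: cusp_near_mono H => E d _ _ <-.
  by rewrite sgr_le0 subr_le0.
- move=> f1 IH1 f2 IH2 /andP[q1 q2] /andP[r1 r2].
  have [b1 H1] := IH1 q1 r1; have [b2 H2] := IH2 q2 r2; exists (b1 && b2).
  by apply: cusp_near_mono (cusp_near_and H1 H2) => E d _ _ [-> ->].
- move=> f1 IH1 f2 IH2 /andP[q1 q2] /andP[r1 r2].
  have [b1 H1] := IH1 q1 r1; have [b2 H2] := IH2 q2 r2; exists (b1 || b2).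
  by apply: cusp_near_mono (cusp_near_and H1 H2) => E d _ _ [-> ->].
- move=> f1 IH1 f2 IH2 /andP[q1 q2] /andP[r1 r2].
  have [b1 H1] := IH1 q1 r1; have [b2 H2] := IH2 q2 r2; exists (b1 ==> b2).
  by apply: cusp_near_mono (cusp_near_and H1 H2) => E d _ _ [-> ->].
- move=> f1 IH1 q1 r1; have [b1 H1] := IH1 q1 r1; exists (~~ b1).
  by apply: cusp_near_mono H1 => E d _ _ ->.
Qed.

(** The truth value is constant on some cusp. At [E = C] a small enough [d] lies both in that cusp
    and in the range where [P] is assumed, so the constant is true. *)
Lemma cusp_near_definable (P : seq R -> Prop) : definable 2 P ->
  (forall E, 1 <= E ->
    exists2 d0, 0 < d0 & forall d, 0 < d -> d <= d0 -> P [:: E; d]) ->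
  cusp_near (fun E d => P [:: E; d]).
Proof.
move=> /definable_qf[f [rf qf Pf]] smallP.
have [b H] := cusp_near_qf qf (rational_rformula rf).
suff bT : b.
  by apply: cusp_near_mono H => E d _ _; rewrite bT Pf // => /ord.qf_evalP; apply.
have [k [C [C1 {}H]]] := H; have [d0 d0gt0 {}smallP] := smallP C C1.
have Ck : 0 < C ^+ k by rewrite exprn_gt0 // (lt_le_trans ltr01).
pose d := Num.min d0 (C ^- k).
have d_gt0 : 0 < d by rewrite lt_min d0gt0 invr_gt0.
rewrite -(H C d) //.
  by apply/ord.qf_evalP => //; rewrite -Pf //; apply: smallP; rewrite // ge_min lexx.
by rewrite -ler_pdivlMr // div1r ge_min lexx orbT.
Qed.

End PolynomialGrowth.

(** * Compactness of the cores *)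

Section Modulus.

Variables (R : realType) (N : nat).
Implicit Types (O : set 'rV[R]_N) (x y z : 'rV[R]_N).

Lemma mx_norm_leP x (r : R) : 0 <= r ->
  (`|x| <= r) <-> (forall i, `|x 0 i| <= r).
Proof.
move=> r0; rewrite [`|x|](mx_normrE x); split=> [H i|H].
  by apply: le_trans H; apply/bigmax_geP; right; exists (0, i).
by apply: bigmax_le => // -[j i] _ /=; rewrite ord1.
Qed.

(** Positivity of [r] covers [N = 0], where the norm is 0 and the coordinate condition is
    vacuous. *)
Lemma mx_norm_ltP x (r : R) : 0 < r ->
  (`|x| < r) <-> (forall i, `|x 0 i| < r).
Proof.
move=> r0; split=> [H i|H].
  by apply: le_lt_trans H; apply: (iffLR (mx_norm_leP x (normr_ge0 _))).
rewrite [`|x|](mx_normrE x); apply: bigmax_lt => // -[j i] _ /=.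
by rewrite ord1.
Qed.

(** A first-order form of the core with a real parameter: the distance bound is stated
    contrapositively, which avoids the infimum and the infinite distance to an empty complement. *)
Definition inner O (E : R) : set 'rV[R]_N :=
  [set x | `|x| <= E /\ forall z, `|x - z| * E < 1 -> O z].

Lemma inner_sub O E : inner O E `<=` O.
Proof. by move=> x [_]; apply; rewrite subrr normr0 mul0r. Qed.

Lemma core_inner O (e : nat) (E : R) :
  (0 < e)%N -> e%:R <= E -> core O e `<=` inner O E.
Proof.
move=> e0 eE x [Ox xe dx]; split; first exact: le_trans eE.
move=> z zE; apply: contrapT => nOz.
have : ((e%:R^-1)%:E <= `|x - z|%:E)%E.
  by apply: (le_trans dx); apply: ereal_inf_lbound; exists z.
rewrite lee_fin => H; move: zE; rewrite ltNge => /negP; apply.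
have eR : 0 < e%:R :> R by rewrite ltr0n.
rewrite -(mulVf (lt0r_neq0 eR)) ler_pM // ?invr_ge0 ltW.
Qed.

(** A strict violation at a limit point [p] leaves some slack, and a point of the set closer to [p]
    than this slack would violate the same condition. *)
Lemma closed_inner O E : 0 < E -> closed (inner O E).
Proof.
move=> E0 p clp; split.
  rewrite leNgt; apply/negP => Ep; rewrite -subr_gt0 in Ep.
  have [q [[qE _]]] := clp _ (nbhsx_ballx p _ Ep).
  rewrite -ball_normE /ball_ /= => pq.
  by have := ler_normD (p - q) q; rewrite subrK; lra.
move=> z; rewrite -ltr_pdivlMr // div1r => pz; rewrite -subr_gt0 in pz.
have [q [[_ qO]]] := clp _ (nbhsx_ballx p _ pz).
rewrite -ball_normE /ball_ /= => pq; apply: qO.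
rewrite -ltr_pdivlMr // div1r.
have := ler_normD (q - p) (p - z); rewrite addrA subrK [`|q - p|]distrC; lra.
Qed.

Lemma compact_inner O E : 0 < E -> compact (inner O E).
Proof.
move=> E0; apply: bounded_closed_compact; last exact: closed_inner.
exists E; split; first exact: num_real.
by move=> M EM x [xE _]; apply: le_trans xE _; rewrite ltW.
Qed.

(** The bound on [F] is bundled in so that [1 / d] also limits the range of the later count. The
    factor 2 reserves half of the error for the rational approximation, and [O y] ensures that [F y]
    is a meaningful value. *)
Definition modulus O (F : 'rV[R]_N -> R) (E d : R) : Prop :=
  forall x, inner O E x -> `|F x| * d <= 1 /\
    forall y, `|x - y| < d -> O y /\ `|F x - F y| * (E *+ 2) < 1.

(** Each point of the inner set has a neighbourhood on which all small [d] work; compactness, in its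
    near-covering form, makes the choice of [d] uniform. *)
Lemma modulus_exists O (F : 'rV[R]_N -> R) (E : R) :
  open O -> {within O, continuous F} -> 0 < E ->
  exists2 d0, 0 < d0 & forall d, 0 < d -> d <= d0 -> modulus O F E d.
Proof.
move=> openO contF E0.
rewrite continuous_open_subspace // in contF.
pose P (d : R) (x : 'rV[R]_N) := `|F x| * d <= 1 /\
    forall y, `|x - y| < d -> O y /\ `|F x - F y| * (E *+ 2) < 1.
have cover : forall x, inner O E x -> \forall x' \near x & d \near 0^'+, P d x'.
  move=> x /inner_sub Ox; pose eps := (E *+ 4)^-1.
  have eps0 : 0 < eps by rewrite invr_gt0 pmulrn_lgt0.
  (* Radius [2 r] controls every [y] within [d < r] of some [x'] within [r] of [x]. Comparing
     through [F x] costs [2 * eps = 1 / (2 E)]. *)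
  have [r r0 xr] : exists2 r, 0 < r & forall y, `|x - y| < r *+ 2 ->
      O y /\ `|F x - F y| < eps.
    have : \forall y \near x, O y /\ `|F x - F y| < eps.
      apply: filterI; first exact: open_nbhs_nbhs.
      by have /cvgrPdist_lt/(_ _ eps0) := contF _ (mem_set Ox).
    move=> /nbhs_ballP[r /= r0 xr]; exists (r / 2); first by rewrite divr_gt0.
    move=> y; rewrite mulr2n -splitr => xy; apply: xr.
    by rewrite -ball_normE.
  pose M := `|F x| + eps.
  have M0 : 0 < M by rewrite ltr_wpDl.
  exists (ball x r, [set d | 0 < d < Num.min r M^-1]).
    split=> /=; first exact: nbhsx_ballx.
    near=> d; apply/andP; split; first by near: d; exact: nbhs_right_gt.
    by near: d; apply: nbhs_right_lt; rewrite lt_min r0 invr_gt0.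
  move=> [x' d] [/= xx' /andP[d0]]; rewrite lt_min => /andP[dr dM].
  rewrite -ball_normE /ball_ /= in xx'.
  have [_ Fxx'] : O x' /\ `|F x - F x'| < eps.
    by apply: xr; rewrite (lt_trans xx') // mulr2n ltrDl.
  split.
    have Fx' : `|F x'| <= M.
      have := ler_normD (F x' - F x) (F x); rewrite subrK distrC /M; lra.
    have := ler_pM (normr_ge0 (F x')) (ltW d0) Fx' (ltW dM).
    by rewrite mulfV // gt_eqF.
  move=> y x'y; have [Oy Fxy] : O y /\ `|F x - F y| < eps.
    apply: xr; have := ler_normD (x - x') (x' - y).
    rewrite addrA subrK mulr2n; lra.
  split=> //; have : `|F x' - F y| < eps *+ 2.
    have := ler_normD (F x' - F x) (F x - F y).
    rewrite addrA subrK [`|F x' - F x|]distrC mulr2n; lra.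
  rewrite -(ltr_pM2r (x := E *+ 2)) ?pmulrn_lgt0 // => /lt_le_trans; apply.
  by rewrite mulrnAl -mulrnAr -mulrnA mulVf // mulrn_eq0 /= gt_eqF.
have H : \forall d \near 0^'+, inner O E `<=` P d.
  exact: (iffLR (compact_near_coveringP _) (@compact_inner O E E0)).
have /nbhs_ballP[d1 /= d1_gt0 {}H] :
  nbhs (0 : R) [set d | 0 < d -> inner O E `<=` P d] := H.
exists (d1 / 2); first by rewrite divr_gt0.
move=> d d0 dd1 x Kx; apply: (H d) => //.
by rewrite -ball_normE /ball_ /= sub0r normrN gtr0_norm //; lra.
Unshelve. all: by end_near. Qed.

End Modulus.

(** * Definability of the modulus *)

Lemma forall_iff T (P Q : T -> Prop) :
  (forall x, P x <-> Q x) -> (forall x, P x) <-> (forall x, Q x).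
Proof. by move=> PQ; split=> H x; apply/PQ. Qed.

Section DefinableModulus.

Variables (R : realType) (N : nat) (O : set 'rV[R]_N) (F : 'rV[R]_N -> R).
Hypotheses (saO : semialgebraic O) (saF : semialgebraic_fun O F).

Lemma definable_norm_lt n (t1 t2 : GRing.term R) :
  rational_term t1 -> rational_term t2 ->
  definable n (fun e => `|GRing.eval e t1| < GRing.eval e t2).
Proof.
move=> r1 r2; have dl := @definable_lt R n (GRing.Opp t2) t1 r2 r1.
apply: eq_definable (definable_and dl (@definable_lt R n t1 t2 r1 r2)) => e _ /=.
by rewrite ltr_norml; split=> [[-> ->]|/andP].
Qed.

Lemma definable_norm_le n (t1 t2 : GRing.term R) :
  rational_term t1 -> rational_term t2 ->
  definable n (fun e => `|GRing.eval e t1| <= GRing.eval e t2).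
Proof.
move=> r1 r2; have dl := @definable_lt R n t2 t1 r2 r1.
have dr := @definable_lt R n t1 (GRing.Opp t2) r1 r2.
apply: eq_definable (definable_and (definable_not dl) (definable_not dr)) => e _ /=.
rewrite ler_norml !leNgt andbC; split=> [[/negP -> /negP ->]//|/andP[/negP ? /negP ?]].
by split.
Qed.

Lemma row_seq_row_mx n (x : 'rV[R]_n) (u : R) :
  row_seq (row_mx x u%:M) = rcons (row_seq x) u.
Proof.
apply: (@eq_from_nth _ 0) => [|i].
  by rewrite size_rcons !size_row_seq addn1.
rewrite size_row_seq => ilt; rewrite (nth_row_seq _ (Ordinal ilt)) nth_rcons.
rewrite size_row_seq; case: ltngtP => [iN|iN|iN].
- rewrite (nth_row_seq x (Ordinal iN)).
  rewrite (_ : Ordinal ilt = lshift 1 (Ordinal iN)); last exact: val_inj.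
  by rewrite row_mxEl.
- by exfalso; move: ilt; rewrite addn1 ltnS leqNgt iN.
- rewrite (_ : Ordinal ilt = rshift n 0); last by apply: val_inj; rewrite /= addn0.
  by rewrite row_mxEr mxE eqxx.
Qed.

Lemma semialgebraic_definable n (A : set 'rV[R]_n) : semialgebraic A ->
  exists2 P, definable n P & forall x, A x <-> P (row_seq x).
Proof.
move=> [phi pf ->]; exists (fun e => ord.holds e phi) => //.
by exists phi => //; exact: parameter_free_rational.
Qed.

(** [F] is not a term of the language, so its values enter formulas as variables constrained by the
    graph. *)
Lemma graph_definable : exists2 P, definable N.+1 P &
  forall x u, P (rcons (row_seq x) u) <-> O x /\ F x = u.
Proof.
have [P dP PE] := semialgebraic_definable saF; exists P.
  by rewrite addn1 in dP.
move=> x u; rewrite -row_seq_row_mx -PE; split=> [[y Oy /eq_row_mx[yx]]|[Ox <-]].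
  rewrite yx in Oy * => /matrixP/(_ 0 0); rewrite !mxE eqxx !mulr1n => <-.
  by split.
by exists x.
Qed.

Let X i : GRing.term R := GRing.Var R i.

(** Norm bounds become coordinatewise inequalities. The value of [F x] is quantified universally,
    that of [F y] existentially, because the conclusion must also provide [O y]. *)
Lemma modulus_definable : exists2 P, definable 2 P &
  forall E d, 0 < E -> 0 < d -> P [:: E; d] <-> modulus O F E d.
Proof.
have [PO dPO POE] := semialgebraic_definable saO.
have [PG dPG PGE] := graph_definable.
(* The entries of the environments are E, d, then x, then (inside P1') z, and
   otherwise u = F x, y and v = F y. *)
pose P4 (w : seq R) := PG (take N.+1 (drop (3 + N) w)) /\
  `|(w`_(2 + N) - w`_(3 + N + N)) * (w`_0 *+ 2)| < 1.
pose P3 (w : seq R) := (forall i : 'I_N, `|w`_(2 + i) - w`_(3 + N + i)| < w`_1) ->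
  exists v, P4 (rcons w v).
pose P2 (w : seq R) := PG (take N.+1 (drop 2 w)) ->
  `|w`_(2 + N) * w`_1| <= 1 /\ forall y : 'rV_N, P3 (w ++ row_seq y).
pose P1' (w : seq R) :=
  (forall i : 'I_N, `|(w`_(2 + i) - w`_(2 + N + i)) * w`_0| < 1) ->
  PO (take N (drop (2 + N) w)).
pose P1 (w : seq R) := (forall i : 'I_N, `|w`_(2 + i)| <= w`_0) ->
  (forall z : 'rV_N, P1' (w ++ row_seq z)) -> forall u, P2 (rcons w u).
exists (fun e => forall x : 'rV_N, P1 (e ++ row_seq x)).
  have d4 : definable (4 + N + N) P4.
    apply: definable_and; first by apply: definable_slice => //; lia.
    exact: (@definable_norm_lt _ (GRing.Mul (GRing.Add (X (2 + N))
      (GRing.Opp (X (3 + N + N)))) (GRing.NatMul (X 0) 2)) (GRing.NatConst R 1)).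
  have d3 : definable (3 + N + N) P3.
    apply: definable_imply; last exact: definable_ex.
    apply: definable_allord => i.
    exact: (@definable_norm_lt _ (GRing.Add (X (2 + i))
      (GRing.Opp (X (3 + N + i)))) (X 1)).
  have d2 : definable (3 + N) P2.
    apply: definable_imply; first by apply: definable_slice => //; lia.
    apply: definable_and; last exact: definable_allrow.
    exact: (@definable_norm_le _ (GRing.Mul (X (2 + N)) (X 1)) (GRing.NatConst R 1)).
  have d1' : definable (2 + N + N) P1'.
    apply: definable_imply; last by apply: definable_slice => //; lia.
    apply: definable_allord => i.
    exact: (@definable_norm_lt _ (GRing.Mul (GRing.Add (X (2 + i))
      (GRing.Opp (X (2 + N + i)))) (X 0)) (GRing.NatConst R 1)).
  apply: definable_allrow; apply: definable_imply.
    by apply: definable_allord => i; exact: (@definable_norm_le _ (X (2 + i)) (X 0)).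
  apply: definable_imply; first exact: definable_allrow.
  exact: definable_all.
move=> E d E0 d0.
have sX (x : 'rV[R]_N) : size (row_seq x) = N by exact: size_row_seq.
have norm1 (x y : 'rV[R]_N) : (`|x - y| * E < 1) <->
    (forall i : 'I_N, `|((row_seq x)`_i - (row_seq y)`_i) * E| < 1).
  rewrite -ltr_pdivlMr // div1r mx_norm_ltP ?invr_gt0 //.
  by split=> H i; move: (H i); rewrite !nth_row_seq !mxE normrM (gtr0_norm E0)
    -ltr_pdivlMr // div1r.
have norm2 (x y : 'rV[R]_N) : (`|x - y| < d) <->
    (forall i : 'I_N, `|(row_seq x)`_i - (row_seq y)`_i| < d).
  by rewrite mx_norm_ltP //; split=> H i; move: (H i); rewrite !nth_row_seq !mxE.
have P4E (x : 'rV[R]_N) u (y : 'rV[R]_N) v :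
    P4 (rcons (rcons ([:: E; d] ++ row_seq x) u ++ row_seq y) v) <->
    (O y /\ F y = v) /\ `|u - v| * (E *+ 2) < 1.
  rewrite /P4 /= !rcons_cat /= -PGE.
  have -> : drop N.+1 (rcons (row_seq x) u ++ rcons (row_seq y) v) =
      rcons (row_seq y) v by rewrite drop_size_cat // size_rcons sX.
  rewrite take_oversize ?size_rcons ?sX //.
  rewrite nth_cat size_rcons sX ltnSn nth_rcons sX ltnn eqxx.
  rewrite nth_cat size_rcons sX -addSn ltnNge leq_addr /= addKn.
  rewrite nth_rcons sX ltnn eqxx normrM (gtr0_norm (_ : 0 < E *+ 2)) //.
  by rewrite pmulrn_lgt0.
have P3E (x : 'rV[R]_N) u (y : 'rV[R]_N) :
    P3 (rcons ([:: E; d] ++ row_seq x) u ++ row_seq y) <->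
    (`|x - y| < d -> O y /\ `|u - F y| * (E *+ 2) < 1).
  rewrite /P3 norm2.
  have -> : (forall i : 'I_N, `|(rcons ([:: E; d] ++ row_seq x) u ++ row_seq y)`_(2 + i)
      - (rcons ([:: E; d] ++ row_seq x) u ++ row_seq y)`_(3 + N + i)|
      < (rcons ([:: E; d] ++ row_seq x) u ++ row_seq y)`_1) <->
     (forall i : 'I_N, `|(row_seq x)`_i - (row_seq y)`_i| < d).
    apply: forall_iff => i /=; rewrite add0n add1n !nth_cat size_rcons sX ltnS ltnW //.
    by rewrite nth_rcons sX ltn_ord ltnNge leq_addr /= addKn.
  split=> H /H.
    by move=> [v /P4E[[Oy <-]]].
  by move=> [Oy Fxy]; exists (F y); apply/P4E.
have P2E (x : 'rV[R]_N) u :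
    P2 (rcons ([:: E; d] ++ row_seq x) u) <-> (O x -> F x = u ->
    `|u| * d <= 1 /\ forall y, `|x - y| < d -> O y /\ `|u - F y| * (E *+ 2) < 1).
  rewrite /P2 /= drop0 take_oversize ?size_rcons ?sX // PGE.
  rewrite nth_rcons sX ltnn eqxx normrM (gtr0_norm d0).
  split=> H.
    by move=> Ox Fx; have [? Hy] := H (conj Ox Fx); split=> // y; apply/P3E/Hy.
  by move=> [Ox Fx]; have [? Hy] := H Ox Fx; split=> // y; apply/P3E/Hy.
have innerE (x : 'rV[R]_N) : inner O E x <->
    (forall i : 'I_N, `|(row_seq x)`_i| <= E) /\
    (forall z : 'rV_N, P1' (([:: E; d] ++ row_seq x) ++ row_seq z)).
  rewrite /inner /= mx_norm_leP ?ltW //.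
  have -> : (forall i, `|x 0 i| <= E) <->
      (forall i : 'I_N, `|(row_seq x)`_i| <= E).
    by apply: forall_iff => i; rewrite nth_row_seq.
  apply: and_iff_compat_l; apply: forall_iff => z.
  rewrite norm1 /P1' /= drop_size_cat // take_oversize ?sX // -POE.
  have -> // : (forall i : 'I_N, `|((row_seq x ++ row_seq z)`_i
      - (row_seq x ++ row_seq z)`_(N + i)) * E| < 1) <->
     (forall i : 'I_N, `|((row_seq x)`_i - (row_seq z)`_i) * E| < 1).
  apply: forall_iff => i; rewrite !nth_cat sX ltn_ord.
  by rewrite ltnNge leq_addr /= addKn.
rewrite /modulus; apply: forall_iff => x; rewrite innerE.
(* The inner set is contained in [O], so [(x, F x)] lies on the graph and [u] can be instantiated
   with [F x]. *)
split=> [H [Hx Hz]|H Hx Hz u].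
  have Ox : O x by apply: (@inner_sub _ _ O E); apply/innerE.
  by have /P2E := H Hx Hz (F x); apply.
by apply/P2E => Ox <-; apply: H.
Qed.

Lemma modulus_polynomial : open O -> {within O, continuous F} ->
  cusp_near (modulus O F).
Proof.
move=> openO contF; have [P dP PE] := modulus_definable.
have cP : cusp_near (fun E d => P [:: E; d]).
  apply: cusp_near_definable => // E E1; have E0 := lt_le_trans ltr01 E1.
  have [d0 d00 H] := modulus_exists openO contF E0; exists d0 => // d dgt0 dd0.
  by apply/PE => //; apply: H.
by apply: cusp_near_mono cP => E d E1 d0; rewrite PE // (lt_le_trans ltr01).
Qed.

(** This is the test applied to each grid point when the value of [F] is found by counting. *)
Lemma hypograph_definable : exists2 P, definable N.+1 P &
  forall b x, P (b :: row_seq x) <-> O x /\ b <= F x.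
Proof.
have [PG dPG PGE] := graph_definable.
exists (fun e => exists u, PG (take N.+1 (drop 1 (rcons e u))) /\
   ~ (rcons e u)`_N.+1 < (rcons e u)`_0).
  apply: (@definable_ex _ _ (fun e => PG (take N.+1 (drop 1 e)) /\
    ~ e`_N.+1 < e`_0)).
  apply: definable_and; first by apply: definable_slice => //; lia.
  exact: definable_not (@definable_lt _ _ (X N.+1) (X 0) _ _).
move=> b x /=; have sX := size_row_seq x.
split=> [[u]|[Ox bF]].
  rewrite drop0 take_oversize ?size_rcons ?sX // PGE.
  by rewrite nth_rcons sX ltnn eqxx => -[[Ox ->]] /negP; rewrite -leNgt.
exists (F x); rewrite drop0 take_oversize ?size_rcons ?sX // PGE.
by rewrite nth_rcons sX ltnn eqxx; split=> //; apply/negP; rewrite -leNgt.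
Qed.

End DefinableModulus.

(** * Lower elementary functions *)

Section LowerElementary.

Implicit Types n : nat.

Lemma lower_elementary_const n c :
  lower_elementary (fun _ : n.-tuple nat => c).
Proof. by move=> C gC; exact: good_const. Qed.

Lemma lower_elementary_proj n (i : 'I_n) :
  lower_elementary (fun x : n.-tuple nat => tnth x i).
Proof. by move=> C gC; exact: good_proj. Qed.

Lemma lower_elementary_comp m n (g : m.-tuple nat -> nat)
    (h : 'I_m -> n.-tuple nat -> nat) :
  lower_elementary g -> (forall i, lower_elementary (h i)) ->
  lower_elementary (fun x => g [tuple h i x | i < m]).
Proof.
move=> lg lh C gC; apply: (good_comp gC); first exact: lg.
by move=> i; exact: lh.
Qed.

Lemma eq_lower_elementary n (f g : n.-tuple nat -> nat) :
  f =1 g -> lower_elementary f -> lower_elementary g.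
Proof. by move=> /funext ->. Qed.

Lemma lower_elementary_comp1 n (u : nat -> nat) (f : n.-tuple nat -> nat) :
  lower_elementary (fun x : 1.-tuple nat => u (tnth x ord0)) ->
  lower_elementary f -> lower_elementary (fun x => u (f x)).
Proof.
move=> lu lf; have := lower_elementary_comp lu (fun _ => lf).
by apply: eq_lower_elementary => x; rewrite tnth_mktuple.
Qed.

Lemma lower_elementary_succ n (f : n.-tuple nat -> nat) :
  lower_elementary f -> lower_elementary (fun x => (f x).+1).
Proof.
by apply: lower_elementary_comp1 => C gC; exact: good_succ.
Qed.

Lemma lower_elementary_sub n (f g : n.-tuple nat -> nat) :
  lower_elementary f -> lower_elementary g ->
  lower_elementary (fun x => f x - g x)%N.
Proof.
move=> lf lg.
have ls : lower_elementary (fun x : 2.-tuple nat => tnth x ord0 - tnth x ord_max)%N.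
  by move=> C gC; exact: good_sub.
have lh (i : 'I_2) : lower_elementary (if i == ord0 then f else g).
  by case: ifP.
have := lower_elementary_comp ls lh.
by apply: eq_lower_elementary => x; rewrite !tnth_mktuple.
Qed.

Lemma tuple_rcons_proj n (x : n.-tuple nat) y :
  [tuple tnth [tuple of rcons x y] (widen_ord (leqnSn n) i) | i < n] = x.
Proof.
apply: eq_from_tnth => i; rewrite tnth_mktuple !(tnth_nth 0%N) /= nth_rcons.
by rewrite size_tuple ltn_ord.
Qed.

Lemma tnth_rcons_last n (x : n.-tuple nat) y :
  tnth [tuple of rcons x y] ord_max = y.
Proof. by rewrite (tnth_nth 0%N) /= nth_rcons size_tuple ltnn eqxx. Qed.

Lemma lower_elementary_init n (f : n.-tuple nat -> nat) :
  lower_elementary f -> lower_elementary (fun x : n.+1.-tuple nat =>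
    f [tuple tnth x (widen_ord (leqnSn n) i) | i < n]).
Proof.
by move=> lf; apply: lower_elementary_comp => // i; exact: lower_elementary_proj.
Qed.

(** The closure axiom sums up to the last argument; composition then substitutes [b x] for that
    argument. *)
Lemma lower_elementary_sum n (g : n.+1.-tuple nat -> nat) (b : n.-tuple nat -> nat) :
  lower_elementary g -> lower_elementary b ->
  lower_elementary (fun x => \sum_(0 <= i < (b x).+1) g [tuple of rcons x i])%N.
Proof.
move=> lg lb; pose f (t : n.+1.-tuple nat) :=
  (\sum_(0 <= i < (tnth t ord_max).+1)
    g [tuple of rcons [tuple tnth t (widen_ord (leqnSn n) i) | i < n] i])%N.
have lf : lower_elementary f.
  move=> C gC; apply: (good_sum gC (lg C gC)) => x y.
  by rewrite /f tuple_rcons_proj tnth_rcons_last.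
pose h (i : 'I_n.+1) (x : n.-tuple nat) := tnth [tuple of rcons x (b x)] i.
have lh i : lower_elementary (h i).
  have [j ->|->] := unliftP ord_max i.
    apply: eq_lower_elementary (lower_elementary_proj j) => x.
    rewrite /h !(tnth_nth 0%N) lift_max /= nth_rcons size_tuple.
    by rewrite ltn_ord.
  by apply: eq_lower_elementary lb => x; rewrite /h tnth_rcons_last.
apply: eq_lower_elementary (lower_elementary_comp lf lh) => x.
have -> : [tuple h i x | i < n.+1] = [tuple of rcons x (b x)].
  by apply: eq_from_tnth => i; rewrite tnth_mktuple.
by rewrite /f tuple_rcons_proj tnth_rcons_last.
Qed.

(** The bound of a sum is inclusive: adding [f x] for the indices up to [g x] gives [g x + 1]
    copies, one of which is subtracted. *)
Lemma lower_elementary_mul n (f g : n.-tuple nat -> nat) :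
  lower_elementary f -> lower_elementary g ->
  lower_elementary (fun x => f x * g x)%N.
Proof.
move=> lf lg.
have := lower_elementary_sub (lower_elementary_sum (lower_elementary_init lf) lg) lf.
apply: eq_lower_elementary => x; rewrite (eq_bigr (fun=> f x)).
  by rewrite sum_nat_const_nat subn0 mulSn addKn mulnC.
by move=> i _; rewrite tuple_rcons_proj.
Qed.

(* x + y is obtained from (x + 1)(y + 1) = xy + x + y + 1. *)
Lemma lower_elementary_add n (f g : n.-tuple nat -> nat) :
  lower_elementary f -> lower_elementary g ->
  lower_elementary (fun x => f x + g x)%N.
Proof.
move=> lf lg; have := lower_elementary_sub (lower_elementary_sub
  (lower_elementary_mul (lower_elementary_succ lf) (lower_elementary_succ lg))
  (lower_elementary_mul lf lg)) (lower_elementary_const n 1).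
by apply: eq_lower_elementary => x; lia.
Qed.

Lemma lower_elementary_exp n (f : n.-tuple nat -> nat) k :
  lower_elementary f -> lower_elementary (fun x => f x ^ k)%N.
Proof.
move=> lf; elim: k => [|k IH]; first exact: lower_elementary_const.
apply: eq_lower_elementary (lower_elementary_mul lf IH) => x.
by rewrite expnS.
Qed.

(** With truncated subtraction, [1 - (1 - (g - f))] is the indicator of [f < g]. *)
Lemma lower_elementary_ltn n (f g : n.-tuple nat -> nat) :
  lower_elementary f -> lower_elementary g ->
  lower_elementary (fun x => nat_of_bool (f x < g x)%N).
Proof.
move=> lf lg; have l1 := lower_elementary_const n 1.
have := lower_elementary_sub l1 (lower_elementary_sub l1 (lower_elementary_sub lg lf)).
by apply: eq_lower_elementary => x; lia.
Qed.

Lemma lower_elementary_and n (p q : n.-tuple nat -> bool) :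
  lower_elementary (fun x => nat_of_bool (p x)) ->
  lower_elementary (fun x => nat_of_bool (q x)) ->
  lower_elementary (fun x => nat_of_bool (p x && q x)).
Proof.
move=> lp lq; apply: eq_lower_elementary (lower_elementary_mul lp lq) => x.
by rewrite mulnb.
Qed.

Lemma lower_elementary_not n (p : n.-tuple nat -> bool) :
  lower_elementary (fun x => nat_of_bool (p x)) ->
  lower_elementary (fun x => nat_of_bool (~~ p x)).
Proof.
move=> lp.
have := lower_elementary_sub (lower_elementary_const n 1) lp.
by apply: eq_lower_elementary => x; case: (p x).
Qed.

End LowerElementary.

(** * Terms and formulas at rational points *)

Lemma ratr_code (R : realType) (q : rat) :
  ratr q = ((tnth (rat_code q) ord0)%:R - (tnth (rat_code q) 1)%:R) /
    (tnth (rat_code q) ord_max)%:R :> R.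
Proof.
rewrite /rat_code !(tnth_nth 0%N) /= /ratr !natr_absz.
rewrite (gtr0_norm (denq_gt0 q)); congr (_ / _).
case: (leP 0 (numq q)) => q0.
  by rewrite (ger0_norm q0) normr0 subr0.
by rewrite (ltr0_norm q0) normr0 sub0r rmorphN /= opprK.
Qed.

Section RationalEvaluation.

Variables (R : realType) (T : Type) (n : nat) (c : T -> n.-tuple nat).

(** The fractions need not be reduced, so no gcd has to be computed under sums and products. The
    identity is required only at the codes [c t]. *)
Definition fraction_valued (v : T -> R) : Prop :=
  exists P Q M : n.-tuple nat -> nat,
    [/\ lower_elementary P, lower_elementary Q, lower_elementary M &
      forall t, (0 < M (c t))%N /\
        v t = ((P (c t))%:R - (Q (c t))%:R) / (M (c t))%:R].

Lemma fraction_valued_rat (q : rat) : fraction_valued (fun=> ratr q).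
Proof.
exists (fun=> tnth (rat_code q) ord0), (fun=> tnth (rat_code q) 1),
  (fun=> tnth (rat_code q) ord_max); split; try exact: lower_elementary_const.
by move=> t; rewrite ratr_code (tnth_nth 0%N) /= absz_gt0 denq_neq0.
Qed.

Lemma fraction_valued_nat (k : nat) : fraction_valued (fun=> k%:R).
Proof.
have := fraction_valued_rat k%:R; congr (fraction_valued _).
by apply: funext => t; rewrite ratr_nat.
Qed.

Lemma fraction_valued_add u v :
  fraction_valued u -> fraction_valued v -> fraction_valued (fun t => u t + v t).
Proof.
move=> [P1 [Q1 [M1 [lP1 lQ1 lM1 H1]]]] [P2 [Q2 [M2 [lP2 lQ2 lM2 H2]]]].
exists (fun x => P1 x * M2 x + P2 x * M1 x)%N, (fun x => Q1 x * M2 x + Q2 x * M1 x)%N,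
  (fun x => M1 x * M2 x)%N; split;
  do ?[apply: lower_elementary_add | apply: lower_elementary_mul | by []].
move=> t; have [m1 ->] := H1 t; have [m2 ->] := H2 t; split.
  by rewrite muln_gt0 m1.
have m1' : (M1 (c t))%:R != 0 :> R by rewrite pnatr_eq0 -lt0n.
have m2' : (M2 (c t))%:R != 0 :> R by rewrite pnatr_eq0 -lt0n.
by rewrite !natrD !natrM; field; rewrite m1' m2'.
Qed.

Lemma fraction_valued_opp u :
  fraction_valued u -> fraction_valued (fun t => - u t).
Proof.
move=> [P [Q [M [lP lQ lM H]]]]; exists Q, P, M; split=> // t.
by have [? ->] := H t; split=> //; rewrite -mulNr opprB.
Qed.

Lemma fraction_valued_mul u v :
  fraction_valued u -> fraction_valued v -> fraction_valued (fun t => u t * v t).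
Proof.
move=> [P1 [Q1 [M1 [lP1 lQ1 lM1 H1]]]] [P2 [Q2 [M2 [lP2 lQ2 lM2 H2]]]].
exists (fun x => P1 x * P2 x + Q1 x * Q2 x)%N, (fun x => P1 x * Q2 x + Q1 x * P2 x)%N,
  (fun x => M1 x * M2 x)%N; split;
  do ?[apply: lower_elementary_add | apply: lower_elementary_mul | by []].
move=> t; have [m1 ->] := H1 t; have [m2 ->] := H2 t; split.
  by rewrite muln_gt0 m1.
have m1' : (M1 (c t))%:R != 0 :> R by rewrite pnatr_eq0 -lt0n.
have m2' : (M2 (c t))%:R != 0 :> R by rewrite pnatr_eq0 -lt0n.
by rewrite !natrD !natrM; field; rewrite m1' m2'.
Qed.

(** If [v - u] is [(P - Q) / M] with [M > 0], the comparison reduces to [Q < P] between natural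
    numbers. *)
Lemma fraction_valued_lt u v : fraction_valued u -> fraction_valued v ->
  exists2 p : n.-tuple nat -> bool,
    lower_elementary (fun x => nat_of_bool (p x)) &
    forall t, p (c t) = (u t < v t).
Proof.
move=> /fraction_valued_opp nu /(fraction_valued_add nu).
move=> [P [Q [M [lP lQ lM H]]]]; exists (fun x => (Q x < P x)%N).
  exact: lower_elementary_ltn.
move=> t; have [m0 E] := H t.
rewrite -[RHS]subr_gt0 addrC E pmulr_lgt0 ?invr_gt0 ?ltr0n //.
by rewrite subr_gt0 ltr_nat.
Qed.

Lemma fraction_valued_eval (env : T -> seq R) (t : GRing.term R) :
  (forall i, fraction_valued (fun z => (env z)`_i)) -> rational_term t ->
  fraction_valued (fun z => GRing.eval (env z) t).
Proof.
move=> He; elim: t => //=.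
- by move=> r /asboolP[q ->]; exact: fraction_valued_rat.
- by move=> k _; exact: fraction_valued_nat.
- by move=> t1 IH1 t2 IH2 /andP[/IH1 ? /IH2 ?]; exact: fraction_valued_add.
- by move=> t1 IH1 /IH1; exact: fraction_valued_opp.
- move=> t1 IH1 k /IH1 f1; have := fraction_valued_mul f1 (fraction_valued_nat k).
  by congr (fraction_valued _); apply: funext => z; rewrite mulr_natr.
- by move=> t1 IH1 t2 IH2 /andP[/IH1 ? /IH2 ?]; exact: fraction_valued_mul.
- move=> t1 IH1 k /IH1 f1; elim: k => [|k IH].
    by have := fraction_valued_nat 1.
  have := fraction_valued_mul f1 IH.
  by congr (fraction_valued _); apply: funext => z; rewrite exprS.
Qed.

Lemma lower_elementary_qf_eval (env : T -> seq R) (f : ord.formula R) :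
  (forall i, fraction_valued (fun z => (env z)`_i)) ->
  rational_formula f -> ord.qf_form f ->
  exists2 p : n.-tuple nat -> bool,
    lower_elementary (fun x => nat_of_bool (p x)) &
    forall z, p (c z) = ord.qf_eval (env z) f.
Proof.
move=> He; pose dec (q : T -> bool) := exists2 p : n.-tuple nat -> bool,
    lower_elementary (fun x => nat_of_bool (p x)) & forall z, p (c z) = q z.
have dec_and q1 q2 : dec q1 -> dec q2 -> dec (fun z => q1 z && q2 z).
  move=> [p1 l1 E1] [p2 l2 E2]; exists (fun x => p1 x && p2 x).
    exact: lower_elementary_and.
  by move=> z; rewrite E1 E2.
have dec_not q : dec q -> dec (fun z => ~~ q z).
  move=> [p l E]; exists (fun x => ~~ p x); first exact: lower_elementary_not.
  by move=> z; rewrite E.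
have eq_dec q1 q2 : q1 =1 q2 -> dec q1 -> dec q2.
  by move=> E [p l Ep]; exists p => // z; rewrite Ep E.
have dec_lt t1 t2 : rational_term t1 -> rational_term t2 ->
    dec (fun z => GRing.eval (env z) t1 < GRing.eval (env z) t2).
  by move=> r1 r2; apply: fraction_valued_lt; apply: fraction_valued_eval.
have dec_le t1 t2 : rational_term t1 -> rational_term t2 ->
    dec (fun z => GRing.eval (env z) t1 <= GRing.eval (env z) t2).
  by move=> r1 r2; apply: eq_dec (dec_not _ (dec_lt _ _ r2 r1)) => z; rewrite leNgt.
elim: f => //=.
- by move=> b _ _; exists (fun=> b) => //; exact: lower_elementary_const.
- move=> t1 t2 /andP[r1 r2] _.
  apply: eq_dec (dec_and _ _ (dec_le _ _ r1 r2) (dec_le _ _ r2 r1)) => z.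
  by rewrite -eq_le.
- by move=> t1 t2 /andP[r1 r2] _; exact: dec_lt.
- by move=> t1 t2 /andP[r1 r2] _; exact: dec_le.
- move=> f1 IH1 f2 IH2 /andP[r1 r2] /andP[q1 q2].
  exact: dec_and (IH1 r1 q1) (IH2 r2 q2).
- move=> f1 IH1 f2 IH2 /andP[r1 r2] /andP[q1 q2].
  apply: eq_dec (dec_not _ (dec_and _ _ (dec_not _ (IH1 r1 q1))
    (dec_not _ (IH2 r2 q2)))) => z.
  by rewrite negb_and !negbK.
- move=> f1 IH1 f2 IH2 /andP[r1 r2] /andP[q1 q2].
  apply: eq_dec (dec_not _ (dec_and _ _ (IH1 r1 q1) (dec_not _ (IH2 r2 q2)))) => z.
  by rewrite negb_and negbK -implybE.
- by move=> f1 IH1 r1 q1; exact: dec_not (IH1 r1 q1).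
Qed.

End RationalEvaluation.

(** * Rational approximation *)

(** The position does not depend on [a] or [e], so each code component of a coordinate is obtained
    by a projection. *)
Lemma input_code_pos N (i : 'I_N) (j : 'I_3) : exists p : 'I_(N * 3).+1,
  forall a e, tnth (input_code a e) p = tnth (rat_code (a 0 i)) j.
Proof.
pose s := allpairs pair (enum 'I_N) (enum 'I_3).
have ss : size s = (N * 3)%N by rewrite size_allpairs !size_enum_ord.
have ps : (index (i, j) s < size s)%N.
  by rewrite index_mem; apply: allpairs_f; rewrite mem_enum.
have pN : (index (i, j) s < (N * 3).+1)%N by rewrite ltnS -ss ltnW.
exists (Ordinal pN) => a e; rewrite (tnth_nth 0%N) /=.
have -> : [seq tnth (rat_code (a 0 x)) y | x <- enum 'I_N, y <- enum 'I_3] =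
    [seq tnth (rat_code (a 0 p.1)) p.2 | p <- s] by rewrite map_allpairs.
by rewrite nth_rcons size_map ps (nth_map (i, j)) // nth_index // -index_mem.
Qed.

Lemma tnth_input_code_last N (a : 'rV[rat]_N) e : tnth (input_code a e) ord_max = e.
Proof. exact: tnth_rcons_last. Qed.

(** Coprimality makes the fraction its own reduced form; the two truncated differences are the
    positive and negative parts of its numerator. *)
Lemma rat_code_fraction (u v m : nat) : (0 < m)%N -> coprimez (u%:Z - v%:Z) m ->
  rat_code ((u%:Z - v%:Z)%:~R / m%:Z%:~R) = [tuple u - v; v - u; m]%N.
Proof.
move=> m0 cop; rewrite /rat_code coprimeq_num // coprimeq_den //.
rewrite gtr0_sg ?ltz_nat // mul1r; apply/val_inj => /=.
by congr [:: _; _; _]; [lia|lia|case: m m0 {cop}].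
Qed.

Lemma sum_leq m L : (m <= L)%N -> (\sum_(0 <= j < L.+1) (j <= m)%N = m.+1)%N.
Proof.
move=> mL; rewrite (@big_cat_nat _ _ _ m.+1) //=.
rewrite (@eq_big_nat _ _ _ _ _ _ (fun=> 1%N)) => [|j /andP[_]]; last first.
  by rewrite ltnS => ->.
rewrite sum_nat_const_nat subn0 muln1 (@eq_big_nat _ _ _ _ _ _ (fun=> 0%N)).
  by rewrite sum_nat_const_nat muln0 addn0.
by move=> j /andP[mj _]; rewrite leqNgt mj.
Qed.

(** With [w = (y + B) n], the grid point of index [j] is at most [y] exactly when [j <= w]. Index 0
    is counted too, so [k] is the integer part of [w] plus one, and [w - k] lies between -1 and
    0. *)
Lemma counting_approx (R : realType) (y : R) (B n k : nat) : (0 < n)%N ->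
  `|y| <= B%:R ->
  k = (\sum_(0 <= j < (2 * (B * n)).+1)
        ((j%:R - (B * n)%:R) / n%:R <= y)%R)%N ->
  `|y - (k%:R / n%:R - B%:R)| <= n%:R^-1.
Proof.
move=> n0 yB ->; have nR : 0 < n%:R :> R by rewrite ltr0n.
move: yB; rewrite ler_norml => /andP[By yB].
set w := (y + B%:R) * n%:R.
have w0 : 0 <= w by apply: mulr_ge0; [lra | exact: ltW].
have /andP[mw wm] := truncn_itv w0; set m := Num.trunc w in mw wm.
(* Since [y <= B], the summation range does not cut off the count. *)
have mL : (m <= 2 * (B * n))%N.
  rewrite -(ler_nat R) (le_trans mw) // /w !natrM mulrA ler_pM2r //.
  by rewrite mulr_natl mulr2n lerD2r.
rewrite (eq_bigr (fun j => nat_of_bool (j <= m)%N)); last first.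
  move=> j _; congr nat_of_bool; rewrite ler_pdivrMr // lerBlDr natrM -mulrDl -/w.
  apply/idP/idP => [jw|jm]; last by rewrite (le_trans _ mw) // ler_nat.
  by rewrite -ltnS -(ltr_nat R) (le_lt_trans jw).
rewrite sum_leq //.
have -> : y - (m.+1%:R / n%:R - B%:R) = (w - m.+1%:R) / n%:R.
  by rewrite /w; field; rewrite gt_eqF.
rewrite normrM normfV (gtr0_norm nR); apply: ler_piMl.
  by rewrite invr_ge0 ltW.
rewrite ler_norml; move: wm mw; rewrite -natr1; lra.
Qed.

Lemma lower_elementary_approx (R : realType) (N : nat) (O : set 'rV[R]_N)
    (F : 'rV[R]_N -> R) (D : nat -> nat) :
  semialgebraic_fun O F ->
  lower_elementary (fun x : 1.-tuple nat => D (tnth x ord0)) ->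
  exists2 f : 'rV[rat]_N -> nat -> rat, lower_elementary_rat f &
    forall a e, O (map_mx ratr a) -> `|F (map_mx ratr a)| <= (D e)%:R ->
      `|F (map_mx ratr a) - ratr (f a e)| <= (2 * e.+1)%:R^-1.
Proof.
move=> saF lD; have [P /definable_qf[psi [rpsi qpsi Ppsi]] PE] := hypograph_definable saF.
(* Counting and the shift by [1 / n^2] each cost at most [1 / n], together [1 / (2 (e + 1))]. The
   successor keeps [n] positive at [e = 0]. *)
pose n e := (4 * e.+1)%N.
have n0 e : (0 < n e)%N by rewrite muln_gt0.
pose T := ('rV[rat]_N * nat * nat)%type.
pose c (z : T) : (N * 3).+2.-tuple nat := [tuple of rcons (input_code z.1.1 z.1.2) z.2].
pose env (z : T) : seq R :=
  (z.2%:R - (D z.1.2 * n z.1.2)%:R) / (n z.1.2)%:R :: row_seq (map_mx ratr z.1.1).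
pose ie : 'I_(N * 3).+2 := widen_ord (leqnSn _) ord_max.
have lift_pos (p : 'I_(N * 3).+1) z :
    tnth (c z) (widen_ord (leqnSn _) p) = tnth (input_code z.1.1 z.1.2) p.
  by rewrite -[in RHS](tuple_rcons_proj (input_code z.1.1 z.1.2) z.2) tnth_mktuple.
have ce z : tnth (c z) ie = z.1.2 by rewrite lift_pos tnth_input_code_last.
have lDcomp m (g : m.-tuple nat -> nat) :
    lower_elementary g -> lower_elementary (fun x => D (g x)).
  exact: lower_elementary_comp1.
have ln m (g : m.-tuple nat -> nat) :
    lower_elementary g -> lower_elementary (fun x => n (g x)).
  move=> lg; apply: lower_elementary_mul; first exact: lower_elementary_const.
  exact: lower_elementary_succ.
have He i : fraction_valued c (fun z => (env z)`_i).
  case: i => [|i] /=.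
    exists (fun x => tnth x ord_max), (fun x => D (tnth x ie) * n (tnth x ie))%N,
      (fun x => n (tnth x ie)); split.
    - exact: lower_elementary_proj.
    - by apply: lower_elementary_mul;
        [apply: lDcomp | apply: ln]; exact: lower_elementary_proj.
    - by apply: ln; exact: lower_elementary_proj.
    - by move=> z; rewrite ce tnth_rcons_last.
  have [iN|iN] := ltnP i N; last first.
    have := fraction_valued_nat R c 0; congr (fraction_valued _ _).
    by apply: funext => z; rewrite nth_default // size_row_seq.
  have [p0 H0] := input_code_pos (Ordinal iN) ord0.
  have [p1 H1] := input_code_pos (Ordinal iN) 1.
  have [p2 H2] := input_code_pos (Ordinal iN) ord_max.
  pose g (p : 'I_(N * 3).+1) (x : (N * 3).+2.-tuple nat) :=
    tnth x (widen_ord (leqnSn _) p).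
  exists (g p0), (g p1), (g p2); split; try exact: lower_elementary_proj.
  move=> z; rewrite /g !lift_pos H0 H1 H2 -ratr_code.
  rewrite (nth_row_seq _ (Ordinal iN)) mxE; split=> //.
  by rewrite (tnth_nth 0%N) /= absz_gt0 denq_neq0.
have [p lp pE] := lower_elementary_qf_eval He rpsi qpsi.
pose K (x : (N * 3).+1.-tuple nat) :=
  (\sum_(0 <= j < (2 * (D (tnth x ord_max) * n (tnth x ord_max))).+1)
     p [tuple of rcons x j])%N.
have lmax : lower_elementary (fun x : (N * 3).+1.-tuple nat => tnth x ord_max).
  exact: lower_elementary_proj.
have lK : lower_elementary K.
  apply: (lower_elementary_sum lp (b := fun x =>
    2 * (D (tnth x ord_max) * n (tnth x ord_max)))%N).
  apply: lower_elementary_mul; first exact: lower_elementary_const.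
  by apply: lower_elementary_mul; [exact: lDcomp | exact: ln].
(* The value [(u - v) / m] equals [K / n - D + 1 / n^2]. *)
pose u x := (K x * n (tnth x ord_max) + 1)%N.
pose v (x : (N * 3).+1.-tuple nat) := (D (tnth x ord_max) * n (tnth x ord_max) ^ 2)%N.
pose m (x : (N * 3).+1.-tuple nat) := (n (tnth x ord_max) ^ 2)%N.
have lu : lower_elementary u.
  apply: lower_elementary_add; last exact: lower_elementary_const.
  by apply: lower_elementary_mul => //; exact: ln.
have lm : lower_elementary m by apply: lower_elementary_exp; exact: ln.
have lv : lower_elementary v.
  by apply: lower_elementary_mul => //; exact: lDcomp.
pose f a e : rat := ((u (input_code a e))%:Z - (v (input_code a e))%:Z)%:~R /
  (m (input_code a e))%:Z%:~R.
exists f.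
  have fE a e : rat_code (f a e) = [tuple u (input_code a e) - v (input_code a e);
      v (input_code a e) - u (input_code a e); m (input_code a e)]%N.
    apply: rat_code_fraction; first by rewrite expn_gt0 n0.
    rewrite /u /v /m; move: (n _) (K _) (D _) => n' K' D'.
    suff : coprimez ((K' * n' + 1)%:Z - (D' * n' ^ 2)%:Z) n'.
      by rewrite !coprimezE => ?; rewrite coprimeXr.
    (* Bezout: the numerator is [(K' - D' n') n' + 1], so adding [(D' n' - K') n'] leaves 1. *)
    apply/coprimezP; exists (1, (D' * n')%:Z - K'%:Z) => /=.
    by rewrite expnS expn1 !PoszD !PoszM; ring.
  case=> -[|[|[|//]]] jlt.
  - exists (fun x => u x - v x)%N; first exact: lower_elementary_sub.
    by move=> a e; rewrite fE (tnth_nth 0%N).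
  - exists (fun x => v x - u x)%N; first exact: lower_elementary_sub.
    by move=> a e; rewrite fE (tnth_nth 0%N).
  - by exists m => // a e; rewrite fE (tnth_nth 0%N).
move=> a e Oa; set y := F _ => yD.
have KE : K (input_code a e) = (\sum_(0 <= j < (2 * (D e * n e)).+1)
        ((j%:R - (D e * n e)%:R) / (n e)%:R <= y)%R)%N.
  rewrite /K tnth_input_code_last; apply: eq_bigr => j _; congr nat_of_bool.
  have -> : p [tuple of rcons (input_code a e) j] = ord.qf_eval (env (a, e, j)) psi.
    exact: (pE (a, e, j)).
  apply/idP/idP => [/(ord.qf_evalP _ qpsi)|H].
    by rewrite -Ppsi /= ?size_row_seq // PE => -[].
  by apply/ord.qf_evalP => //; rewrite -Ppsi /= ?size_row_seq // PE.
have nR : 0 < (n e)%:R :> R by rewrite ltr0n n0.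
have -> : ratr (f a e) =
    (K (input_code a e))%:R / (n e)%:R - (D e)%:R + (n e)%:R^-1 ^+ 2 :> R.
  rewrite /f /u /v /m tnth_input_code_last fmorph_div /= !ratr_int rmorphB /=.
  by rewrite -!pmulrn natrD ?(natrX, natrM); field; rewrite gt_eqF.
have ky := counting_approx (n0 e) yD KE.
have -> : (2 * e.+1)%:R^-1 = (n e)%:R^-1 + (n e)%:R^-1 :> R.
  have e1 : e.+1%:R != 0 :> R by rewrite pnatr_eq0.
  by rewrite /n !natrM; move: e.+1%:R e1 => t t0; field.
rewrite opprD addrA (le_trans (ler_normB _ _)) // lerD //.
rewrite ger0_norm ?sqr_ge0 // expr2; apply: ler_piMl.
  by rewrite invr_ge0 ltW.
by rewrite invf_le1 ?ler1n.
Qed.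

(** * Combination of the modulus with the rational approximation *)

Theorem theorem4p2 (R : realType) (N : nat) (O : set 'rV[R]_N)
    (F : 'rV[R]_N -> R)
    (openO : open O) (saO : semialgebraic O)
    (contF : {within O, continuous F}) (saF : semialgebraic_fun O F) :
  lower_elementary_real O F.
Proof.
have [k [C [C1 modF]]] := modulus_polynomial saO saF openO contF.
have [c0 C_c0] : exists c0 : nat, C <= c0%:R.
  exists (Num.bound C); apply/ltW/archi_boundP; exact: le_trans C1.
have c0_gt0 : (0 < c0)%N by rewrite -(ltr_nat R) (lt_le_trans ltr01) // (le_trans C1).
(* For [E = e + c0] one has [E >= e], so the core lies in the inner set, and [E >= C], so
   [(E, 1 / d e)] lies in the cusp. *)
pose d e := ((e + c0) ^ k)%N.
have d_gt0 e : (0 < d e)%N by rewrite expn_gt0 addn_gt0 c0_gt0 orbT.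
have ld : lower_elementary (fun x : 1.-tuple nat => d (tnth x ord0)).
  apply: lower_elementary_exp; apply: lower_elementary_add.
    exact: lower_elementary_proj.
  exact: lower_elementary_const.
(* The modulus bounds [F x] by [d e]; the extra 1 accounts for passing from [x] to the rational
   point [a]. *)
have [f lf fF] := @lower_elementary_approx R N O F (fun e => (d e).+1) saF
  (lower_elementary_succ ld).
exists d, f; split=> // e a x e_gt0 corex xa.
pose E : R := (e + c0)%:R.
have eE : e%:R <= E by rewrite ler_nat leq_addr.
have CE : C <= E by rewrite (le_trans C_c0) // ler_nat leq_addl.
have dR : 0 < (d e)%:R :> R by rewrite ltr0n.
have dE : (d e)%:R^-1 * E ^+ k <= 1 by rewrite -natrX mulVf // gt_eqF.
have di : 0 < (d e)%:R^-1 :> R by rewrite invr_gt0.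
have [Fxd /(_ _ xa)[Oa Fxa]] := modF E _ CE di dE x (core_inner e_gt0 eE corex).
rewrite ler_pdivrMr // mul1r in Fxd.
have eR : 1 <= e%:R :> R by rewrite ler1n.
have {}Fxa : `|F x - F (map_mx ratr a)| < (2 * e)%:R^-1.
  rewrite -div1r ltr_pdivlMr ?ltr0n ?muln_gt0 //; apply: le_lt_trans Fxa.
  by rewrite ler_wpM2l // natrM mulr_natl ler_wMn2r.
have e2 : (2 * e)%:R^-1 <= 1 :> R by rewrite invf_le1 ?ltr0n ?ler1n muln_gt0.
have Fa : `|F (map_mx ratr a)| <= (d e).+1%:R.
  have := ler_normD (F (map_mx ratr a) - F x) (F x).
  rewrite subrK distrC -natr1; lra.
have fa := fF a e Oa Fa.
have dist3 := ler_distD (F (map_mx ratr a)) (F x) (ratr (f a e)).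
have e3 : (2 * e.+1)%:R^-1 <= (2 * e)%:R^-1 :> R.
  by rewrite lef_pV2 ?posrE ?ltr0n ?muln_gt0 // ler_nat leq_mul2l leqnSn.
(* One half bounds the change of [F] from [x] to [a], strictly; the other half bounds the error of
   [f] at [a]. *)
have -> : e%:R^-1 = (2 * e)%:R^-1 + (2 * e)%:R^-1 :> R.
  by rewrite natrM; field; rewrite gt_eqF // (lt_le_trans ltr01).
apply: le_lt_trans dist3 _; apply: ltr_leD => //.
exact: le_trans fa e3.
Qed.
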